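(* Let $m,r\ge1$. For $1\le k\le m$ let $\alpha_k,\gamma_k\in\mathbb{C}$, $\beta_k,\lambda_k\in\mathbb{C}^*$, $g_k$ a complex polynomial in one variable, with $\lambda_1,\ldots,\lambda_m$ pairwise distinct; for $1\le k\le r$ let $\xi_k,\omega_k\in\mathbb{C}$, $\epsilon_k,\mu_k\in\mathbb{C}^*$, $h_k$ a complex polynomial in one variable, with $\mu_1,\ldots,\mu_r$ pairwise distinct. Consider the simple $U(L)$-modules $$\mathbf{T}(\boldsymbol{\alpha},\boldsymbol{\beta},\boldsymbol{\gamma},\boldsymbol{\lambda},\boldsymbol{g})=\bigotimes_{k=1}^{m}\Omega(\alpha_k,\beta_k,\gamma_k,\lambda_k,g_k),\qquad \mathbf{T}(\boldsymbol{\xi},\boldsymbol{\epsilon},\boldsymbol{\omega},\boldsymbol{\mu},\boldsymbol{h})=\bigotimes_{k=1}^{r}\Omega(\xi_k,\epsilon_k,\omega_k,\mu_k,h_k).$$ Then $\mathbf{T}(\boldsymbol{\alpha},\boldsymbol{\beta},\boldsymbol{\gamma},\boldsymbol{\lambda},\boldsymbol{g})\cong\mathbf{T}(\boldsymbol{\xi},\boldsymbol{\epsilon},\boldsymbol{\omega},\boldsymbol{\mu},\boldsymbol{h})$ as $U(L)$-modules if and only if $m=r$ and, up to a permutation of the indices, $(\alpha_k,\beta_k,\gamma_k,\lambda_k,g_k)=(\xi_k,\epsilon_k,\omega_k,\mu_k,h_k)$ for all $1\le k\le m$; that is, there is a permutation $\sigma$ of $\{1,\ldots,m\}$ with $(\alpha_k,\beta_k,\gamma_k,\lambda_k,g_k)=(\xi_{\sigma(k)},\epsilon_{\sigma(k)},\omega_{\sigma(k)},\mu_{\sigma(k)},h_{\sigma(k)})$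 for all $1\le k\le m$ (polynomials being compared after renaming the variable).
   Context: $\mathbb{C}^*$ denotes the non-zero complex numbers. $L=\mathcal{W}\ltimes\widehat{H_4}$ is the complex Lie algebra with $\mathbb{C}$-basis $\{L_n,a_n,b_n,c_n,d_n\mid n\in\mathbb{Z}\}$ and non-vanishing brackets $[L_m,L_n]=(n-m)L_{m+n}$, $[L_m,x_n]=n\,x_{m+n}$ for $x\in\{a,b,c,d\}$, $[a_m,b_n]=c_{m+n}$, $[d_m,a_n]=a_{m+n}$, $[d_m,b_n]=-b_{m+n}$ (for $m,n\in\mathbb{Z}$). $U(L)$ is its universal enveloping algebra. For $\alpha,\gamma\in\mathbb{C}$, $\beta,\lambda\in\mathbb{C}^*$ and $g\in\mathbb{C}[t]$, $\Omega(\alpha,\beta,\gamma,\lambda,g)$ is the polynomial space $\mathbb{C}[s,t]$ with the $U(L)$-action given, for $n\in\mathbb{Z}$ and $f(s,t)\in\mathbb{C}[s,t]$, by $$L_n f(s,t)=\lambda^n(s+n\alpha)f(s-n,t),$$ $$d_n f(s,t)=\lambda^n\beta^{-1}\left(tg(t)+\gamma\right)f(s-n,t)+\lambda^n t\,\partial_t f(s-n,t),$$ $$a_n f(s,t)=\lambda^n t f(s-n,t),$$ $$b_n f(s,t)=\lambda^n g(t) f(s-n,t)+\lambda^n \beta\, \partial_t f(s-n,t),$$ $$c_n f(s,t)=-\lambda^n\beta f(s-n,t).$$ The $k$-th tensor factor is realized on $\mathbb{C}[s_k,t_k]$ (variables $s_k,t_k$ in place of $s,t$), tensor products are over $\mathbb{C}$,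 and $L$ acts on the tensor product in the usual way, $x(v_1\otimes\cdots\otimes v_m)=\sum_{k}v_1\otimes\cdots\otimes xv_k\otimes\cdots\otimes v_m$ for $x\in L$. Such a tensor product is simple exactly when its parameters $\lambda_k$ are pairwise distinct. *)

(* Defs.v *)
From HB Require Import structures.
From mathcomp Require Import all_boot all_order all_algebra.
From mathcomp Require Import finmap boolp reals complex.
From mathcomp Require Import monalg.
From mathcomp Require Import ring.

Set Implicit Arguments.
Unset Strict Implicit.
Unset Printing Implicit Defensive.

Import GRing.Theory.
Local Open Scope ring_scope.
Local Open Scope quotient_scope.

(* {malg F[K]} is used throughout as the F-vector space with basis K,
   whose basis vectors are << k >>. *)
Section LinearExtension.
Variables (F : fieldType) (K : choiceType) (W : lmodType F).

Definition malg_lift (h : K -> W) (x : {malg F[K]}) : W :=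
  \sum_(k <- msupp x) x@_k *: h k.

Lemma malg_liftEw (h : K -> W) (d : {fset K}) (x : {malg F[K]}) :
  (msupp x `<=` d)%fset -> malg_lift h x = \sum_(k <- d) x@_k *: h k.
Proof.
move=> le; rewrite /malg_lift (big_fset_incl _ le) // => k _ /mcoeff_outdom ->.
by rewrite scale0r.
Qed.

Lemma malg_lift_is_linear (h : K -> W) : linear (malg_lift h).
Proof.
move=> a x y; pose d := (msupp x `|` msupp y)%fset.
have lex : (msupp x `<=` d)%fset by apply: fsubsetUl.
have ley : (msupp y `<=` d)%fset by apply: fsubsetUr.
have le : (msupp (a *: x + y) `<=` d)%fset.
  apply: (fsubset_trans (msuppD_le _ _)).
  by apply: fsetSU; apply: msuppZ_le.
rewrite (malg_liftEw _ lex) (malg_liftEw _ ley) (malg_liftEw _ le).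
rewrite scaler_sumr -big_split /=; apply: eq_bigr => k _.
by rewrite mcoeffD mcoeffZ scalerDl scalerA.
Qed.

HB.instance Definition _ (h : K -> W) :=
  GRing.isLinear.Build F {malg F[K]} W _ (malg_lift h) (malg_lift_is_linear h).

Lemma malg_liftU (h : K -> W) k : malg_lift h << k >> = h k.
Proof.
by rewrite /malg_lift msuppU oner_eq0 big_seq_fset1 mcoeffUU scale1r.
Qed.

Lemma malg_lin_ind (P : {malg F[K]} -> Prop) :
  P 0 -> (forall a u v, P u -> P v -> P (a *: u + v)) ->
  (forall k, P << k >>) -> forall x, P x.
Proof.
move=> P0 PZD PU x; rewrite (monalgE x); elim/big_rec: _ => // k y _ Py.
have -> : << x@_k *g k >> = x@_k *: << k >> :> {malg F[K]}.
  by apply/malgP => j; rewrite mcoeffZ !mcoeffU mulrnAr mulr1.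
exact: PZD.
Qed.

End LinearExtension.

Lemma malg_lift_linr (F : fieldType) (K : choiceType) (V W : lmodType F)
    (h : K -> V -> W) (x : {malg F[K]}) :
  (forall k, linear (h k)) -> linear (fun v => malg_lift (h^~ v) x).
Proof.
move=> hl a u v; rewrite /malg_lift scaler_sumr -big_split /=.
apply: eq_bigr => k _.
by rewrite hl scalerDr !scalerA mulrC.
Qed.

Record lieAlgebra (F : fieldType) := LieAlgebra {
  lie_sort :> lmodType F;
  lie_bracket : lie_sort -> lie_sort -> lie_sort;
  lie_bracketl : forall y, linear (lie_bracket^~ y);
  lie_bracketr : forall x, linear (lie_bracket x);
  lie_bracketxx : forall x, lie_bracket x x = 0;
  lie_jacobi : forall x y z,
    lie_bracket x (lie_bracket y z) + lie_bracket y (lie_bracket z x)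
      + lie_bracket z (lie_bracket x y) = 0 }.

(* A module over the universal enveloping algebra U(L), presented by the
   action of L. *)
Record lieModule (F : fieldType) (L : lieAlgebra F) := LieModule {
  liemod_sort :> lmodType F;
  lie_act : L -> liemod_sort -> liemod_sort;
  lie_actl : forall v, linear (lie_act^~ v);
  lie_actr : forall x, linear (lie_act x);
  lie_act_bracket : forall x y v,
    lie_act (lie_bracket x y) v =
      lie_act x (lie_act y v) - lie_act y (lie_act x v) }.

Definition lieModule_iso (F : fieldType) (L : lieAlgebra F)
    (V W : lieModule L) : Prop :=
  exists f : {linear V -> W},
    bijective f /\ forall (x : L) (v : V), f (lie_act x v) = lie_act x (f v).

Section Multilinear.
Variables (F : fieldType) (I : finType) (V : I -> lmodType F).

(* dfwith v x is the family v with its i-th entry replaced by x : V i. *)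
Definition multilinear (W : lmodType F) (phi : (forall i, V i) -> W) : Prop :=
  forall (v : forall i, V i) (i : I), linear (fun x : V i => phi (dfwith v x)).

End Multilinear.

Section TensorProduct.
Variables (F : fieldType) (I : finType) (V : I -> lmodType F).

Local Notation free := {malg F[forall i, V i]}.

Inductive tensor_null : free -> Prop :=
| TensorNull0 : tensor_null 0
| TensorNullZD a u v :
    tensor_null u -> tensor_null v -> tensor_null (a *: u + v)
| TensorNullLin (v : forall i, V i) i a (x y : V i) :
    tensor_null (<< dfwith v (a *: x + y) >>
                 - (a *: << dfwith v x >> + << dfwith v y >>)).

Definition tensor_nullb : free -> bool := fun u => `[< tensor_null u >].

Lemma tensor_nullD u v : tensor_null u -> tensor_null v -> tensor_null (u + v).
Proof. by move=> /(@TensorNullZD 1 u v) + nv => /(_ nv); rewrite scale1r. Qed.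

Lemma tensor_nullZ a u : tensor_null u -> tensor_null (a *: u).
Proof. by move=> /(@TensorNullZD a u 0) /(_ TensorNull0); rewrite addr0. Qed.

Lemma tensor_nullb_zmod : zmod_closed tensor_nullb.
Proof.
split=> [|u v /asboolP nu /asboolP nv]; apply/asboolP; first exact: TensorNull0.
by apply: tensor_nullD => //; rewrite -scaleN1r; apply: tensor_nullZ.
Qed.

HB.instance Definition _ :=
  GRing.isZmodClosed.Build free tensor_nullb tensor_nullb_zmod.

Definition tensor_nulls := GRing.ZmodClosed.clone _ tensor_nullb _.

Definition tensor : Type := Quotient.quot tensor_nulls.
HB.instance Definition _ := GRing.Zmodule.on tensor.

Definition tensor_class (u : free) : tensor :=
  \pi_(Quotient.quot tensor_nulls) u.

Lemma tensor_classD u v :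
  tensor_class (u + v) = tensor_class u + tensor_class v.
Proof. exact: raddfD. Qed.

Lemma tensor_class_eq u v :
  tensor_class u = tensor_class v <-> tensor_null (u - v).
Proof.
split=> [/eqP|h].
  by rewrite -[_ == _]/(_ == _ %[mod _]) -Quotient.idealrBE => /asboolP.
apply/eqP; rewrite -[_ == _]/(_ == _ %[mod _]) -Quotient.idealrBE.
exact/asboolP.
Qed.

Definition tensor_repr (t : tensor) : free :=
  repr (t : Quotient.quot tensor_nulls).

Lemma tensor_reprK t : tensor_class (tensor_repr t) = t.
Proof. exact: reprK. Qed.

Lemma tensor_class_ind (P : tensor -> Prop) :
  (forall u, P (tensor_class u)) -> forall t, P t.
Proof. by move=> Pu t; rewrite -(tensor_reprK t). Qed.

Definition tensor_scale (a : F) (t : tensor) : tensor :=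
  tensor_class (a *: tensor_repr t).

Lemma tensor_scaleE a u :
  tensor_scale a (tensor_class u) = tensor_class (a *: u).
Proof.
apply/tensor_class_eq; rewrite -scalerBr; apply: tensor_nullZ.
by apply/tensor_class_eq; rewrite tensor_reprK.
Qed.

Lemma tensor_scaleA a b t :
  tensor_scale a (tensor_scale b t) = tensor_scale (a * b) t.
Proof.
by elim/tensor_class_ind: t => u; rewrite !tensor_scaleE scalerA.
Qed.

Lemma tensor_scale1 : left_id 1 tensor_scale.
Proof. by elim/tensor_class_ind => u; rewrite tensor_scaleE scale1r. Qed.

Lemma tensor_scaleDr : right_distributive tensor_scale +%R.
Proof.
move=> a; elim/tensor_class_ind => u; elim/tensor_class_ind => v.
by rewrite -tensor_classD !tensor_scaleE scalerDr tensor_classD.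
Qed.

Lemma tensor_scaleDl t : {morph tensor_scale^~ t : a b / a + b}.
Proof.
elim/tensor_class_ind: t => u a b.
by rewrite !tensor_scaleE scalerDl tensor_classD.
Qed.

HB.instance Definition _ := GRing.Zmodule_isLmodule.Build F tensor
  tensor_scaleA tensor_scale1 tensor_scaleDr tensor_scaleDl.

Lemma tensor_class_is_linear : linear tensor_class.
Proof.
by move=> a u v; rewrite tensor_classD -tensor_scaleE.
Qed.

HB.instance Definition _ :=
  GRing.isLinear.Build F free tensor _ tensor_class tensor_class_is_linear.

Definition pure_tensor (v : forall i, V i) : tensor := tensor_class << v >>.

Lemma pure_tensor_multilinear : multilinear pure_tensor.
Proof.
move=> v i a x y; rewrite /pure_tensor -linearP; apply/tensor_class_eq.
exact: TensorNullLin.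
Qed.

Lemma tensor_ind (P : tensor -> Prop) :
  P 0 -> (forall a s t, P s -> P t -> P (a *: s + t)) ->
  (forall v, P (pure_tensor v)) -> forall t, P t.
Proof.
move=> P0 PZD Pp; elim/tensor_class_ind; elim/malg_lin_ind => [|a u v Pu Pv|v].
- by rewrite linear0.
- by rewrite linearP; apply: PZD.
- exact: Pp.
Qed.

(* The linear map induced by phi; meaningful when phi is multilinear. *)
Definition tensor_lift (W : lmodType F) (phi : (forall i, V i) -> W)
    (t : tensor) : W :=
  malg_lift phi (tensor_repr t).

Section Lift.
Variables (W : lmodType F) (phi : (forall i, V i) -> W).
Hypothesis phi_lin : multilinear phi.

Lemma tensor_lift_class u : tensor_lift phi (tensor_class u) = malg_lift phi u.
Proof.
apply/eqP; rewrite -subr_eq0 -linearB /=; apply/eqP.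
have : tensor_null (tensor_repr (tensor_class u) - u).
  by apply/tensor_class_eq; rewrite tensor_reprK.
elim=> [|a x y _ ex _ ey|v i a x y]; first exact: linear0.
  by rewrite linearP /= ex ey scaler0 addr0.
by rewrite linearB linearP /= !malg_liftU phi_lin subrr.
Qed.

Lemma tensor_lift_pure v : tensor_lift phi (pure_tensor v) = phi v.
Proof. by rewrite tensor_lift_class malg_liftU. Qed.

Lemma tensor_lift_is_linear : linear (tensor_lift phi).
Proof.
move=> a; elim/tensor_class_ind => u; elim/tensor_class_ind => v.
by rewrite -linearP !tensor_lift_class linearP.
Qed.

End Lift.

End TensorProduct.

Section TensorModule.
Variables (F : fieldType) (L : lieAlgebra F) (I : finType).
Variable V : I -> lieModule L.

Local Notation fam := (forall i, V i).

Definition leibniz (x : L) (v : fam) : tensor V :=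
  \sum_i pure_tensor (dfwith v (lie_act x (v i))).

Definition tensor_act (x : L) : tensor V -> tensor V :=
  tensor_lift (leibniz x).

Lemma dfwith_twice (v : fam) i (x y : V i) :
  dfwith (dfwith v x) y = dfwith v y.
Proof.
apply: functional_extensionality_dep => j.
by have [<-|ij] := eqVneq i j; rewrite ?dfwith_in ?dfwith_out.
Qed.

Lemma dfwith_swap (v : fam) i j (x : V i) (y : V j) : i != j ->
  dfwith (dfwith v x) y = dfwith (dfwith v y) x.
Proof.
move=> ij; apply: functional_extensionality_dep => k.
have [ik|ik] := eqVneq i k.
  by subst k; rewrite dfwith_in dfwith_out 1?eq_sym // dfwith_in.
rewrite [RHS]dfwith_out //.
by have [jk|jk] := eqVneq j k; [subst k; rewrite !dfwith_in|rewrite !dfwith_out].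
Qed.

Lemma leibniz_multilinear x : multilinear (leibniz x).
Proof.
move=> v i a y z; rewrite /leibniz scaler_sumr -big_split /=.
apply: eq_bigr => j _; have [<-|ij] := eqVneq i j.
  by rewrite !dfwith_in !dfwith_twice lie_actr pure_tensor_multilinear.
rewrite !(dfwith_out _ _ ij) !(dfwith_swap _ _ _ ij).
by rewrite pure_tensor_multilinear.
Qed.

Lemma tensor_act_pure x v : tensor_act x (pure_tensor v) = leibniz x v.
Proof. exact/tensor_lift_pure/leibniz_multilinear. Qed.

Lemma tensor_actr x : linear (tensor_act x).
Proof. exact/tensor_lift_is_linear/leibniz_multilinear. Qed.

HB.instance Definition _ x :=
  GRing.isLinear.Build F (tensor V) (tensor V) _ (tensor_act x) (tensor_actr x).

Lemma tensor_act0 x : tensor_act x 0 = 0.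
Proof. exact: linear0. Qed.

Lemma tensor_act_sum x (f : I -> tensor V) :
  tensor_act x (\sum_i f i) = \sum_i tensor_act x (f i).
Proof. exact: linear_sum. Qed.

Lemma tensor_actl t : linear (tensor_act^~ t).
Proof.
move=> a x y; elim/tensor_ind: t => [|b s t es et|v].
- by rewrite !tensor_act0 scaler0 addr0.
- rewrite !tensor_actr es et !scalerDr !scalerA [b * a]mulrC.
  exact: addrACA.
- rewrite !tensor_act_pure /leibniz scaler_sumr -big_split /=.
  by apply: eq_bigr => i _; rewrite lie_actl pure_tensor_multilinear.
Qed.

Lemma tensor_act_bracket x y t :
  tensor_act (lie_bracket x y) t =
    tensor_act x (tensor_act y t) - tensor_act y (tensor_act x t).
Proof.
elim/tensor_ind: t => [|b s t es et|v].
- by rewrite !tensor_act0 subr0.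
- by rewrite !tensor_actr es et scalerBr opprD addrACA.
rewrite !tensor_act_pure /leibniz !tensor_act_sum.
pose G (p q : L) (i j : I) :=
  pure_tensor (dfwith (dfwith v (lie_act q (v i)))
                      (lie_act p (dfwith v (lie_act q (v i)) j))).
have E (p q : L) : \sum_i tensor_act p (pure_tensor (dfwith v (lie_act q (v i))))
    = \sum_i \sum_j G p q i j.
  by apply: eq_bigr => i _; rewrite tensor_act_pure.
rewrite !E [X in _ - X]exchange_big -sumrB; apply: eq_bigr => i _.
rewrite -sumrB (bigD1 i) //= big1 ?addr0 => [|j ji].
  have D (a b : V i) :
      pure_tensor (dfwith v (a - b)) =
      pure_tensor (dfwith v a) - pure_tensor (dfwith v b).
    have := pure_tensor_multilinear v (-1) b a.
    by rewrite !scaleN1r [- b + a]addrC [LHS]/= => ->; rewrite addrC.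
  by rewrite /G !dfwith_in !dfwith_twice lie_act_bracket D.
apply/eqP; rewrite subr_eq0; apply/eqP.
have ij : i != j by rewrite eq_sym.
by rewrite /G (dfwith_out _ _ ij) (dfwith_out _ _ ji) dfwith_swap.
Qed.

Definition tensor_module : lieModule L :=
  LieModule tensor_actl tensor_actr tensor_act_bracket.

End TensorModule.

Section ThreeTerms.
Variables (F : fieldType) (W : lmodType F).

Lemma scale_sum3_eq0 (a : F) (u u' v v' w w' : W) :
  u + v + w = 0 -> u' + v' + w' = 0 ->
  (a *: u + u') + (a *: v + v') + (a *: w + w') = 0.
Proof.
move=> e e'; rewrite (addrACA (a *: u)) (addrACA (a *: u + a *: v)) -!scalerDr e e'.
by rewrite scaler0 addr0.
Qed.

Lemma scale_coef3_eq0 (k l p : F) (u : W) :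
  k + l + p = 0 -> k *: u + l *: u + p *: u = 0.
Proof. by move=> e; rewrite -!scalerDl e scale0r. Qed.

End ThreeTerms.

(* BasisL n stands for L_n, and BasisH h n for the element h t^n of the loop
   algebra of H_4; the four generators of H_4 are a, b, c, d. *)
Inductive h4 : Type := H4a | H4b | H4c | H4d.

Inductive wh_basis : Type := BasisL of int | BasisH of h4 & int.

HB.instance Definition _ := gen_eqMixin wh_basis.
HB.instance Definition _ := gen_choiceMixin wh_basis.

(* The pair (k, z) encodes the bracket [x, y] = k z. *)
Definition h4_bracket (x y : h4) : int * h4 :=
  match x, y with
  | H4a, H4b => (1, H4c)
  | H4b, H4a => (-1, H4c)
  | H4d, H4a => (1, H4a)
  | H4a, H4d => (-1, H4a)
  | H4d, H4b => (-1, H4b)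
  | H4b, H4d => (1, H4b)
  | _, _ => (0, H4c)
  end.

Section WH4.
Variable F : fieldType.

Local Notation wh_space := {malg F[wh_basis]}.

Definition wh_basis_bracket (x y : wh_basis) : wh_space :=
  match x, y with
  | BasisL m, BasisL n => (n - m)%:~R *: << BasisL (m + n) >>
  | BasisL m, BasisH h n => n%:~R *: << BasisH h (m + n) >>
  | BasisH h m, BasisL n => (- m)%:~R *: << BasisH h (m + n) >>
  | BasisH g m, BasisH h n =>
      (h4_bracket g h).1%:~R *: << BasisH (h4_bracket g h).2 (m + n) >>
  end.

Definition wh_bracket (x y : wh_space) : wh_space :=
  malg_lift (fun e => malg_lift (wh_basis_bracket e) y) x.

Lemma wh_bracketUU e e' :
  wh_bracket << e >> << e' >> = wh_basis_bracket e e'.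
Proof. by rewrite /wh_bracket !malg_liftU. Qed.

Lemma wh_bracketl y : linear (wh_bracket^~ y).
Proof. by move=> a u v; rewrite /wh_bracket linearP. Qed.

Lemma wh_bracketr x : linear (wh_bracket x).
Proof.
apply: (malg_lift_linr (h := fun e => malg_lift (wh_basis_bracket e))) => e.
exact: malg_lift_is_linear.
Qed.

HB.instance Definition _ x :=
  GRing.isLinear.Build F wh_space wh_space _ (wh_bracket x) (wh_bracketr x).

Lemma wh_bracket0l y : wh_bracket 0 y = 0.
Proof. by rewrite /wh_bracket linear0. Qed.

Lemma wh_bracket0r x : wh_bracket x 0 = 0.
Proof. exact: linear0. Qed.

Lemma wh_bracketC x y : wh_bracket x y = - wh_bracket y x.
Proof.
elim/malg_lin_ind: x => [|a u v eu ev|e].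
- by rewrite wh_bracket0l linear0 oppr0.
- by rewrite wh_bracketl wh_bracketr eu ev scalerN opprD.
elim/malg_lin_ind: y => [|a u v eu ev|e'].
- by rewrite wh_bracket0l linear0 oppr0.
- by rewrite wh_bracketl wh_bracketr eu ev scalerN opprD.
rewrite !wh_bracketUU; case: e e' => [m|g m] [n|h n] /=;
  rewrite [n + m]addrC -scaleNr -mulrNz.
- by rewrite opprB.
- by rewrite opprK.
- by [].
- by congr (_ *: _); case: g h => [] [].
Qed.

Lemma wh_bracketxx x : wh_bracket x x = 0.
Proof.
elim/malg_lin_ind: x => [|a u v eu ev|e].
- exact: linear0.
- rewrite wh_bracketl !wh_bracketr eu ev [wh_bracket v u]wh_bracketC.
  by rewrite scaler0 add0r addr0 scalerN subrr.
rewrite wh_bracketUU; case: e => [m|h m] /=; first by rewrite subrr scale0r.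
by case: h; rewrite /= scale0r.
Qed.

Local Opaque wh_bracket.

Lemma wh_jacobi x y z :
  wh_bracket x (wh_bracket y z) + wh_bracket y (wh_bracket z x)
    + wh_bracket z (wh_bracket x y) = 0.
Proof.
elim/malg_lin_ind: x => [|a u v eu ev|e].
- by rewrite !(wh_bracket0l, wh_bracket0r) !addr0.
- rewrite !wh_bracketl !wh_bracketr; exact: (scale_sum3_eq0 a eu ev).
elim/malg_lin_ind: y => [|a u v eu ev|e'].
- by rewrite !(wh_bracket0l, wh_bracket0r) !addr0.
- rewrite !wh_bracketl !wh_bracketr ?wh_bracketl; exact: (scale_sum3_eq0 a eu ev).
elim/malg_lin_ind: z => [|a u v eu ev|e''].
- by rewrite !(wh_bracket0l, wh_bracket0r) !addr0.
- rewrite !wh_bracketl !wh_bracketr ?wh_bracketl; exact: (scale_sum3_eq0 a eu ev).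
rewrite !wh_bracketUU.
have brZ d (k : F) d' :
    wh_bracket << d >> (k *: << d' >>) = k *: wh_basis_bracket d d'.
  by rewrite linearZ /= wh_bracketUU.
have E1 (m n p : int) : n + (p + m) = m + (n + p) by ring.
have E2 (m n p : int) : p + (m + n) = m + (n + p) by ring.
have hC1 g h : (h4_bracket g h).1 = - (h4_bracket h g).1 by case: g h => [] [].
have hC2 g h : (h4_bracket g h).2 = (h4_bracket h g).2 by case: g h => [] [].
have Z1 (k : F) (u : wh_space) : k = 0 -> k *: u = 0 by move=> ->; rewrite scale0r.
case: e e' e'' => [m|f m] [n|g n] [p|h p] /=; rewrite !brZ /= !scalerA.
all: rewrite ?(E1 m n p) ?(E2 m n p).
- by apply: scale_coef3_eq0; ring.
- by apply: scale_coef3_eq0; ring.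
- by apply: scale_coef3_eq0; ring.
- by rewrite (hC1 h g) (hC2 h g); apply: scale_coef3_eq0; ring.
- by apply: scale_coef3_eq0; ring.
- by rewrite (hC1 h f) (hC2 h f); apply: scale_coef3_eq0; ring.
- by rewrite (hC1 g f) (hC2 g f); apply: scale_coef3_eq0; ring.
case: f g h => [] [] [] /=;
  rewrite ?(mulr0z, mulr0, mul0r, scale0r, addr0, add0r) -?scalerDl //;
  apply: Z1; ring.
Qed.

Definition WH4 : lieAlgebra F :=
  LieAlgebra wh_bracketl wh_bracketr wh_bracketxx wh_jacobi.

End WH4.

From mathcomp Require Import mpoly.

(* C[s, t]. The notation {mpoly F[2]} is avoided because monalg also declares
   it, for a different type. *)
Notation poly_st F := (mpoly 2 F).

Section Omega.
Variables (F : fieldType) (alpha beta gamma lambda : F) (g : {poly F}).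

Local Notation s := ('X_ord0 : poly_st F).
Local Notation t := ('X_ord_max : poly_st F).
Local Notation "''d_t' f" := (f^`M(ord_max)) (at level 10, f at level 8).

(* f(s - n, t) *)
Definition shift_s (n : int) (f : poly_st F) : poly_st F :=
  f \mPo [tuple s - (n%:~R)%:MP; t].

Definition poly_in_t : poly_st F := horner_alg t g.

Definition omega_basis_act (x : wh_basis) (f : poly_st F) : poly_st F :=
  match x with
  | BasisL n => lambda ^ n *: ((s + (n%:~R * alpha)%:MP) * shift_s n f)
  | BasisH H4d n =>
      (lambda ^ n * beta^-1) *: ((t * poly_in_t + gamma%:MP) * shift_s n f)
        + lambda ^ n *: (t * 'd_t (shift_s n f))
  | BasisH H4a n => lambda ^ n *: (t * shift_s n f)
  | BasisH H4b n =>
      lambda ^ n *: (poly_in_t * shift_s n f)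
        + (lambda ^ n * beta) *: 'd_t (shift_s n f)
  | BasisH H4c n => - (lambda ^ n * beta) *: shift_s n f
  end.

Definition omega_act (x : WH4 F) (f : poly_st F) : poly_st F :=
  malg_lift (omega_basis_act^~ f) x.

Lemma shift_sD n f h : shift_s n (f + h) = shift_s n f + shift_s n h.
Proof. exact: rmorphD. Qed.

Lemma shift_sM n f h : shift_s n (f * h) = shift_s n f * shift_s n h.
Proof. exact: rmorphM. Qed.

Lemma shift_sC n c : shift_s n c%:MP = c%:MP.
Proof. exact: comp_mpolyC. Qed.

Lemma shift_sZ n c f : shift_s n (c *: f) = c *: shift_s n f.
Proof. exact: comp_mpolyZ. Qed.

Lemma shift_s_s n : shift_s n s = s - (n%:~R)%:MP.
Proof. exact: comp_mpolyXU. Qed.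

Lemma shift_s_t n : shift_s n t = t.
Proof. exact: comp_mpolyXU. Qed.

Lemma mpoly_st_ind (P : poly_st F -> Prop) :
  (forall c, P c%:MP) -> P s -> P t ->
  (forall f h, P f -> P h -> P (f + h)) ->
  (forall f h, P f -> P h -> P (f * h)) -> forall f, P f.
Proof.
move=> PC Ps Pt PD PM; elim/mpolyind => [|c m p _ _ Pp].
  by rewrite -mpolyC0.
have PX (f : poly_st F) k : P f -> P (f ^+ k).
  by move=> Pf; elim: k => [|k IH]; rewrite ?expr0 ?exprS -?mpolyC1; auto.
apply: (PD) => //; rewrite -mul_mpolyC; apply: (PM) => //.
rewrite mpolyXE_id !big_ord_recl big_ord0 mulr1.
by apply: (PM); apply: PX.
Qed.

Lemma shift_s_shift m n f : shift_s m (shift_s n f) = shift_s (m + n) f.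
Proof.
elim/mpoly_st_ind: f => [c|||f h ef eh|f h ef eh].
- by rewrite !shift_sC.
- have -> : shift_s n s = s + (- n%:~R)%:MP by rewrite shift_s_s mpolyCN.
  rewrite shift_sD shift_sC !shift_s_s -addrA -mpolyCN -mpolyCD -opprD -intrD.
  by rewrite mpolyCN.
- by rewrite !shift_s_t.
- by rewrite !shift_sD ef eh.
- by rewrite !shift_sM ef eh.
Qed.

Lemma mderiv_s : 'd_t s = 0.
Proof. by rewrite mderivX mnmE /= scale0r. Qed.

Lemma mderiv_t : 'd_t t = 1.
Proof. rewrite mderivX mnmE eqxx scale1r -mpolyX0; congr 'X_[_].
by apply/mnmP => i; rewrite mnmBE subnn mnm0E. Qed.

Lemma mderiv_shift_s n f : 'd_t (shift_s n f) = shift_s n ('d_t f).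
Proof.
elim/mpoly_st_ind: f => [c|||f h ef eh|f h ef eh].
- by rewrite shift_sC mderivC -mpolyC0 shift_sC.
- by rewrite shift_s_s mderivB mderivC mderiv_s subr0 -mpolyC0 shift_sC.
- by rewrite shift_s_t mderiv_t -mpolyC1 shift_sC.
- by rewrite shift_sD !mderivD ef eh shift_sD.
- by rewrite shift_sM !mderivM ef eh !shift_sD !shift_sM.
Qed.

Lemma shift_s_g n : shift_s n poly_in_t = poly_in_t.
Proof.
rewrite /poly_in_t; elim/poly_ind: g => [|p c ep].
  by rewrite rmorph0 -mpolyC0 shift_sC.
rewrite rmorphD rmorphM /= horner_algX horner_algC shift_sD shift_sM ep.
by rewrite shift_s_t -mul_mpolyC mulr1 shift_sC.
Qed.

Lemma omega_basis_act_linear x : linear (omega_basis_act x).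
Proof.
move=> a u v.
have sP n : shift_s n (a *: u + v) = a *: shift_s n u + shift_s n v.
  by rewrite shift_sD shift_sZ.
by case: x => [n|[] n] /=; rewrite sP ?mderivD ?mderivZ -!mul_mpolyC; ring.
Qed.

Lemma omega_actl f : linear (omega_act^~ f).
Proof. exact: malg_lift_is_linear. Qed.

Lemma omega_actr x : linear (omega_act x).
Proof. exact/malg_lift_linr/omega_basis_act_linear. Qed.

Lemma omega_actU e f : omega_act << e >> f = omega_basis_act e f.
Proof. exact: malg_liftU. Qed.

Hypotheses (beta0 : beta != 0) (lambda0 : lambda != 0).

Lemma omega_basis_act_bracket e e' f :
  omega_act (wh_basis_bracket F e e') f =
    omega_basis_act e (omega_basis_act e' f)
    - omega_basis_act e' (omega_basis_act e f).
Proof.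
have actZ (k : F) d : omega_act (k *: << d >>) f = k *: omega_basis_act d f.
  have /= := omega_actl f k << d >> 0.
  rewrite addr0 => ->; rewrite omega_actU.
  have -> : omega_act 0 f = 0 by exact: linear0.
  exact: addr0.
have lD m n : lambda ^ (m + n) = lambda ^ m * lambda ^ n by exact: expfzDr.
pose G1 := beta^-1 *: poly_in_t.
have EG : poly_in_t = beta%:MP * G1.
  by rewrite mul_mpolyC scalerA divff // scale1r.
have shG n : shift_s n G1 = G1 by rewrite shift_sZ shift_s_g.
have Ed n h : omega_basis_act (BasisH H4d n) h =
    (lambda ^ n)%:MP * ((t * G1 + (beta^-1 * gamma)%:MP) * shift_s n h
                        + t * 'd_t (shift_s n h)).
  rewrite /= EG -!mul_mpolyC !mpolyCM.
  have: (beta^-1)%:MP * beta%:MP = 1 :> poly_st F.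
    by rewrite -mpolyCM mulVf.
  move: (_^-1)%:MP => bi eb.
  transitivity ((lambda ^ n)%:MP * ((t * ((bi * beta%:MP) * G1) + bi * gamma%:MP)
     * shift_s n h + t * 'd_t (shift_s n h))); first by ring.
  by rewrite eb mul1r.
have EL n h : omega_basis_act (BasisL n) h =
    (lambda ^ n)%:MP * ((s + (n%:~R * alpha)%:MP) * shift_s n h).
  by rewrite /= -!mul_mpolyC.
have Ea n h : omega_basis_act (BasisH H4a n) h =
    (lambda ^ n)%:MP * (t * shift_s n h).
  by rewrite /= -!mul_mpolyC.
have Eb n h : omega_basis_act (BasisH H4b n) h =
    (lambda ^ n)%:MP * beta%:MP * (G1 * shift_s n h + 'd_t (shift_s n h)).
  by rewrite /= EG -!mul_mpolyC !mpolyCM; ring.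
have Ec n h : omega_basis_act (BasisH H4c n) h =
    - (lambda ^ n)%:MP * beta%:MP * shift_s n h.
  by rewrite /= -!mul_mpolyC mpolyCN !mpolyCM; ring.
have shN n h : shift_s n (- h) = - shift_s n h by exact: rmorphN.
have dM (h k : poly_st F) : 'd_t (h * k) = 'd_t h * k + h * 'd_t k.
  exact: mderivM.
have dD (h k : poly_st F) : 'd_t (h + k) = 'd_t h + 'd_t k by exact: mderivD.
have dN (h : poly_st F) : 'd_t (- h) = - 'd_t h by exact: mderivN.
have dC (c : F) : 'd_t (c%:MP : poly_st F) = 0 by exact: mderivC.
have lZ (c : F) (h : poly_st F) : c *: h = c%:MP * h by rewrite mul_mpolyC.
(* The operators and variables become opaque, so that rewriting is fast. *)
move: EL Ea Eb Ec Ed shN shG dM dD dN dC shift_sM shift_sD shift_sC shift_s_s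
  shift_s_t shift_s_shift mderiv_s mderiv_t mderiv_shift_s actZ lD.
move: omega_act omega_basis_act shift_s ('X_ord0 : poly_st F)
  ('X_ord_max : poly_st F) (mderiv (R := F) (ord_max : 'I_2)) G1 EG.
move=> act bact sh x y D G1 _ EL Ea Eb Ec Ed shN shG dM dD dN dC shM shD shC.
move=> shx shy shsh dx dy dsh actZ lD.
have shDG n : sh n (D G1) = D G1 by rewrite -dsh shG.
case: e e' => [m|[] m] [n|[] n]; rewrite [wh_basis_bracket _ _ _]/= actZ;
  rewrite !(EL, Ea, Eb, Ec, Ed).
all: rewrite ?(shM, shD, shN).
all: rewrite ?shC ?shx ?shy ?shG ?dsh ?shsh.
all: rewrite ?(dM, dD, dN).
all: rewrite ?dC ?dx ?dy ?dsh ?shDG.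
all: rewrite ?[n + m]addrC lD.
all: rewrite lZ.
all: rewrite ?mpolyCM.
all: ring.
Qed.

Lemma omega_act_bracket x y f :
  omega_act (lie_bracket x y) f =
    omega_act x (omega_act y f) - omega_act y (omega_act x f).
Proof.
have act0 h : omega_act 0 h = 0 by exact: linear0.
have actr0 z : omega_act z 0 = 0.
  by have := omega_actr z (-1) 0 0; rewrite scaler0 addr0 scaleN1r addNr.
have br0l z : lie_bracket (0 : WH4 F) z = 0 by exact: wh_bracket0l.
have br0r z : lie_bracket z (0 : WH4 F) = 0 by exact: wh_bracket0r.
elim/malg_lin_ind: x => [|a u v eu ev|e].
- by rewrite br0l !act0 actr0 subr0.
- rewrite lie_bracketl !omega_actl omega_actr eu ev.
  by rewrite scalerBr opprD addrACA.
elim/malg_lin_ind: y => [|a u v eu ev|e'].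
- by rewrite br0r !act0 actr0 subr0.
- rewrite lie_bracketr !omega_actl omega_actr eu ev.
  by rewrite scalerBr opprD addrACA.
rewrite !omega_actU -omega_basis_act_bracket; congr omega_act.
exact: wh_bracketUU.
Qed.

Definition Omega : lieModule (WH4 F) :=
  LieModule omega_actl omega_actr omega_act_bracket.

End Omega.

Arguments Omega {F} alpha beta gamma lambda g beta0 lambda0.

(* Main.v *)
(* Let w be the image of 1 under an isomorphism f from the first tensor product
   to the second.  For fixed u, each of L_n u, a_n u, b_n u, c_n u, d_n u is,
   as a function of n >= 0, a sum over the factors of sequences lambda_k^n times
   a polynomial in n, that is, of generalized eigenvectors of the shift of
   sequences for the eigenvalues lambda_k.  As these are distinct, an identity
   between such sums splits into one identity for each eigenvalue.
   - c_n 1 gives {lambda_k} = {mu_j}, hence the matching of the factors, and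
     beta_k = epsilon_j when lambda_k = mu_j.  It also shows that f preserves
     the elements in which no s_k occurs.
   - L_n 1 gives alpha_k = xi_j, and a_n shows that f(q(t_k)) = q(t_j) w.
   - b_n 1 gives g_k(t_j) w = h_j(t_j) w + epsilon_j dw/dt_j.  As the derivation
     is locally nilpotent and w is not a torsion element, this forces g_k = h_j
     and dw/dt_j = 0.
   - d_n 1 then gives gamma_k = omega_j. *)
From HB Require Import structures.
Require Import Defs.
From mathcomp Require Import all_boot all_order all_algebra perm.
From mathcomp Require Import reals complex boolp monalg mpoly ring.

Set Implicit Arguments.
Unset Strict Implicit.
Unset Printing Implicit Defensive.

Import GRing.Theory.
Local Open Scope ring_scope.

(** * Sequences and their generalized eigenvectors under the shift *)

Section SequenceAction.
Variables (F : fieldType) (W : lmodType F).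
Implicit Types (p q : {poly F}) (v : nat -> W) (c : F).

(** The action of [{poly F}] on sequences for which ['X] is the shift: the value at [n] of [p]
    applied to [v]. *)
Definition shift_poly p v (n : nat) : W :=
  \sum_(i < size p) p`_i *: v (n + i)%N.

Lemma shift_polyEw d p v n : (size p <= d)%N ->
  shift_poly p v n = \sum_(i < d) p`_i *: v (n + i)%N.
Proof.
move=> le; rewrite /shift_poly.
rewrite (big_ord_widen _ (fun i => p`_i *: v (n + i)%N) le) big_mkcond.
apply: eq_bigr => i _; case: ltnP => // /(nth_default 0) ->.
by rewrite scale0r.
Qed.

Lemma shift_polyD p q v n :
  shift_poly (p + q) v n = shift_poly p v n + shift_poly q v n.
Proof.
pose d := maxn (size p) (size q).
rewrite (@shift_polyEw d p) ?leq_maxl // (@shift_polyEw d q) ?leq_maxr //.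
rewrite (@shift_polyEw d) ?size_polyD // -big_split /=; apply: eq_bigr => i _.
by rewrite coefD scalerDl.
Qed.

Lemma shift_polyC c v n : shift_poly c%:P v n = c *: v n.
Proof.
rewrite (@shift_polyEw 1) ?size_polyC_leq1 // big_ord_recl big_ord0 addr0.
by rewrite coefC addn0.
Qed.

Lemma shift_polyMX p v n : shift_poly (p * 'X) v n = shift_poly p v n.+1.
Proof.
rewrite (@shift_polyEw (size p).+1); last first.
  by have [->|p0] := eqVneq p 0; rewrite ?mul0r ?size_poly0 // size_mulX.
rewrite big_ord_recl coefMX scale0r add0r; apply: eq_bigr => i _.
by rewrite coefMX /= addSnnS.
Qed.

Lemma shift_poly_sum (I : Type) (s : seq I) (P : pred I) p
    (v : I -> nat -> W) n :
  shift_poly p (fun n => \sum_(i <- s | P i) v i n) n =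
    \sum_(i <- s | P i) shift_poly p (v i) n.
Proof.
by rewrite exchange_big /=; apply: eq_bigr => i _; rewrite scaler_sumr.
Qed.

Lemma shift_polyD_seq p v w n :
  shift_poly p (fun n => v n + w n) n = shift_poly p v n + shift_poly p w n.
Proof.
by rewrite -big_split; apply: eq_bigr => i _; rewrite scalerDr.
Qed.

Lemma shift_polyZ_seq p c v n :
  shift_poly p (fun n => c *: v n) n = c *: shift_poly p v n.
Proof.
by rewrite scaler_sumr; apply: eq_bigr => i _; rewrite !scalerA mulrC.
Qed.

Lemma eq_shift_poly p v w : v =1 w -> shift_poly p v =1 shift_poly p w.
Proof. by move=> e n; apply: eq_bigr => i _; rewrite e. Qed.

Lemma shift_poly0 p v n : (forall n, v n = 0) -> shift_poly p v n = 0.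
Proof.
by move=> v0; rewrite /shift_poly big1 // => i _; rewrite v0 scaler0.
Qed.

Lemma shift_polyM p q v n :
  shift_poly (p * q) v n = shift_poly p (shift_poly q v) n.
Proof.
elim/poly_ind: p n => [|p c IH] n.
  by rewrite mul0r /shift_poly size_poly0 !big_ord0.
rewrite mulrDl !shift_polyD -mulrAC !shift_polyMX IH; congr (_ + _).
rewrite mul_polyC shift_polyC (@shift_polyEw (size q)) ?size_scale_leq //.
by rewrite scaler_sumr; apply: eq_bigr => i _; rewrite coefZ scalerA.
Qed.

(* v is a generalized eigenvector, for the eigenvalue c, of the shift
   (v n)_n |-> (v n.+1)_n. *)
Definition gen_eigenseq c v :=
  exists N, forall n, shift_poly (('X - c%:P) ^+ N) v n = 0.

Lemma shift_polyXsubC c v n : shift_poly ('X - c%:P) v n = v n.+1 - c *: v n.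
Proof.
rewrite -polyCN -['X]mul1r -polyC1 shift_polyD shift_polyMX !shift_polyC.
by rewrite scale1r scaleNr.
Qed.

Lemma gen_eigenseq0 c v : (forall n, v n = 0) -> gen_eigenseq c v.
Proof. by move=> v0; exists 0%N => n; apply: shift_poly0. Qed.

(** Applying ['X - c%:P] once raises the exponent by one. This is the induction step for [c ^+ n]
    times a polynomial in [n]. *)
Lemma gen_eigenseq_step c v :
  gen_eigenseq c (fun n => v n.+1 - c *: v n) -> gen_eigenseq c v.
Proof.
case=> N e; exists N.+1 => n; rewrite exprSr shift_polyM -[RHS](e n).
by apply: eq_shift_poly => k; apply: shift_polyXsubC.
Qed.

Lemma gen_eigenseq_le N c v :
  (forall n, shift_poly (('X - c%:P) ^+ N) v n = 0) ->
  forall M, (N <= M)%N -> forall n, shift_poly (('X - c%:P) ^+ M) v n = 0.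
Proof.
move=> e M /subnK <- n; rewrite exprD shift_polyM.
exact: shift_poly0.
Qed.

Lemma gen_eigenseqZ c a v :
  gen_eigenseq c v -> gen_eigenseq c (fun n => a *: v n).
Proof.
by case=> N e; exists N => n; rewrite shift_polyZ_seq e scaler0.
Qed.

Lemma gen_eigenseqD c v w : gen_eigenseq c v -> gen_eigenseq c w ->
  gen_eigenseq c (fun n => v n + w n).
Proof.
case=> N ev [M ew]; exists (N + M)%N => n; rewrite shift_polyD_seq.
rewrite (gen_eigenseq_le ev) ?leq_addr // (gen_eigenseq_le ew) ?leq_addl //.
exact: addr0.
Qed.

Lemma eq_gen_eigenseq c v w : v =1 w -> gen_eigenseq c v -> gen_eigenseq c w.
Proof. by move=> e [N ev]; exists N => n; rewrite -(eq_shift_poly _ e). Qed.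

Lemma gen_eigenseq_expr c u : gen_eigenseq c (fun n => c ^+ n *: u).
Proof.
by apply/gen_eigenseq_step/gen_eigenseq0 => n; rewrite scalerA -exprS subrr.
Qed.

(** The operator ['X - c%:P] lowers the degree in [n]: it sends this sequence to the eigenvector
    [c ^+ n *: (c *: u)]. *)
Lemma gen_eigenseq_exprn c u : gen_eigenseq c (fun n => c ^+ n *: (n%:R *: u)).
Proof.
apply/gen_eigenseq_step/(eq_gen_eigenseq _ (gen_eigenseq_expr c (c *: u))) => n.
by rewrite !scalerA -exprS -scalerBl -natr1 mulrDr mulr1 addrC addKr -exprSr.
Qed.

(** The part [vc] for [c] is minus the rest [vd]. A power of ['X - c%:P] kills the former and a
    product of powers of the other factors kills the latter, so both kill [vc]. They are coprime,
    and Bezout gives [vc = 0]. *)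
Lemma gen_eigenseq_separation (K : finType) (nu : K -> F) (v : K -> nat -> W) :
  (forall k, gen_eigenseq (nu k) (v k)) -> (forall n, \sum_k v k n = 0) ->
  forall c n, \sum_(k | nu k == c) v k n = 0.
Proof.
move=> gv sum0 c.
pose ev N := forall k n, shift_poly (('X - (nu k)%:P) ^+ N) (v k) n = 0.
have {gv} [N vN] : exists N, ev N.
  have [N vN] := fin_all_exists gv.
  (* The sum of the exponents bounds each of them, so it serves for all [k] at once. *)
  exists (\sum_k N k)%N => k; apply: (gen_eigenseq_le (vN k)).
  by rewrite (bigD1 k) //= leq_addr.
pose vc n := \sum_(k | nu k == c) v k n.
pose vd n := \sum_(k | nu k != c) v k n.
have vcd n : vc n = - vd n.
  apply/eqP; rewrite -addr_eq0 -(sum0 n).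
  by rewrite [eqbRHS](bigID (fun k => nu k == c)).
pose p := ('X - c%:P) ^+ N.
pose q := \prod_(k | nu k != c) ('X - (nu k)%:P) ^+ N.
have pv n : shift_poly p vc n = 0.
  by rewrite shift_poly_sum big1 // => k /eqP kc; rewrite /p -kc.
have qv n : shift_poly q vc n = 0.
  rewrite (eq_shift_poly _ (w := fun n => -1 *: vd n)) => [|k]; last first.
    by rewrite scaleN1r vcd.
  rewrite shift_polyZ_seq shift_poly_sum big1 ?scaler0 // => k kc.
  rewrite /q (bigD1 k) //= mulrC shift_polyM; exact: shift_poly0.
have /Bezout_eq1_coprimepP[[a b] /= e1] : coprimep p q.
  apply: (big_ind (coprimep p)) => [|x y ex ey|k kc];
    rewrite ?coprimep1 ?coprimepMr ?ex //.
  apply/coprimep_expl/coprimep_expr; rewrite coprimep_XsubC rootE hornerXsubC.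
  by rewrite subr_eq0.
move=> n; rewrite -[LHS]/(vc n) -[LHS]scale1r -shift_polyC polyC1 -e1.
by rewrite shift_polyD !shift_polyM !shift_poly0 ?addr0.
Qed.

(** Separation applied to the disjoint union [I + J], with a minus sign on the second family. *)
Lemma gen_eigenseq_match (I J : finType) (mu : I -> F) (nu : J -> F)
    (v : I -> nat -> W) (w : J -> nat -> W) :
  (forall i, gen_eigenseq (mu i) (v i)) ->
  (forall j, gen_eigenseq (nu j) (w j)) ->
  (forall n, \sum_i v i n = \sum_j w j n) ->
  forall c n, \sum_(i | mu i == c) v i n = \sum_(j | nu j == c) w j n.
Proof.
move=> gv gw e c n.
pose mn (k : I + J) := match k with inl i => mu i | inr j => nu j end.
pose vw (k : I + J) n := match k with inl i => v i n | inr j => -1 *: w j n end.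
have gvw k : gen_eigenseq (mn k) (vw k).
  by case: k => [i|j]; [apply: gv|apply: (gen_eigenseqZ (-1) (gw j))].
have vw0 k : \sum_i vw i k = 0.
  by rewrite big_sumType /= e -scaler_sumr scaleN1r subrr.
have := gen_eigenseq_separation gvw vw0 c n; rewrite big_sumType /=.
by rewrite -scaler_sumr scaleN1r => /eqP; rewrite subr_eq0 => /eqP.
Qed.

End SequenceAction.

Lemma iter_linear_ge (F : fieldType) (W : lmodType F) (f : {linear W -> W})
  N M v : (N <= M)%N -> iter N f v = 0 -> iter M f v = 0.
Proof.
move=> /subnK <- e; rewrite iterD e; elim: (_ - _)%N => //= n ->.
exact: linear0.
Qed.

(* e = 0 covers derivations, and e = 1 covers sigma - 1 for a ring morphism
   sigma. *)
Lemma locally_nilpotentM (F : fieldType) (A : algType F) (D : {linear A -> A})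
    (e : F) :
  (forall x y, D (x * y) = D x * y + x * D y + e *: (D x * D y)) ->
  forall a b x y, iter a D x = 0 -> iter b D y = 0 ->
  iter (a + b) D (x * y) = 0.
Proof.
move=> DM a b; move: {2}(a + b)%N (leqnn (a + b)) => n.
(* Induction on a bound for [a + b]: in each term of [D (x * y)] the exponents of the two factors
   have a smaller sum. *)
elim: n a b => [|n IH] a b le x y.
  move: le; rewrite leqn0 addn_eq0 => /andP[/eqP-> /eqP->] /= -> _.
  by rewrite mul0r.
have z m : iter m D 0 = 0 by apply: (iter_linear_ge (leq0n m)).
have lin m c u v : iter m D (c *: u + v) = c *: iter m D u + iter m D v.
  by elim: m => //= m ->; rewrite linearP.
case: a le => [|a] le xa yb; first by rewrite (xa : x = 0) mul0r z.
case: b le yb => [|b] le yb; first by rewrite (yb : y = 0) mulr0 z.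
rewrite iterSr in xa; rewrite iterSr in yb.
rewrite addSn iterSr DM addrC lin.
have -> : D x * y + x * D y = 1 *: (D x * y) + x * D y by rewrite scale1r.
rewrite addSn ltnS in le; have le' : (a.+1 + b <= n)%N by rewrite addSnnS.
have ba : (a + b <= n)%N by apply: leq_trans le; rewrite leq_add2l.
have xyb : iter (a + b) D (D x * D y) = 0 by apply: IH.
have xyl : iter (a + b.+1) D (D x * y) = 0 by apply: IH => //; rewrite iterSr.
have xyr : iter (a + b.+1) D (x * D y) = 0.
  by rewrite -addSnnS; apply: IH => //; rewrite iterSr.
rewrite !lin xyl xyr (iter_linear_ge _ xyb) ?leq_add2l //.
by rewrite !scaler0 !addr0.
Qed.

(** * Operators on one factor of a tensor product *)

Section DfWith.
Variables (I : eqType) (T : I -> Type) (v : forall i, T i).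

Lemma dfwith_idem i (x y : T i) : dfwith (dfwith v x) y = dfwith v y.
Proof.
apply: functional_extensionality_dep => j.
by have [<-|ij] := eqVneq i j; rewrite ?dfwith_in ?dfwith_out.
Qed.

Lemma dfwith_id i : dfwith v (v i) = v.
Proof.
apply: functional_extensionality_dep => j.
by have [<-|ij] := eqVneq i j; rewrite ?dfwith_in ?dfwith_out.
Qed.

Lemma dfwithC i j (x : T i) (y : T j) : i != j ->
  dfwith (dfwith v x) y = dfwith (dfwith v y) x.
Proof.
move=> ij; apply: functional_extensionality_dep => k.
have [ik|ik] := eqVneq i k.
  by subst k; rewrite dfwith_in dfwith_out 1?eq_sym // dfwith_in.
rewrite [RHS]dfwith_out //.
have [jk|jk] := eqVneq j k; last by rewrite !dfwith_out.
by subst k; rewrite !dfwith_in.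
Qed.

End DfWith.

Section Slot.
Variables (F : fieldType) (I : finType) (V : I -> lmodType F).
Implicit Types (i j : I) (t : tensor V) (v : forall i, V i).

Lemma eq_tensor_linear (W : lmodType F) (f g : {linear tensor V -> W}) :
  (forall v, f (pure_tensor v) = g (pure_tensor v)) -> f =1 g.
Proof.
move=> e; elim/tensor_ind => [|a s t es et|v]; rewrite ?linear0 ?linearP //=.
by rewrite es et.
Qed.

Lemma pure_tensor0 v i : pure_tensor (dfwith v (0 : V i)) = 0.
Proof.
have := pure_tensor_multilinear v (-1) (0 : V i) 0.
by rewrite scaler0 addr0 scaleN1r addNr.
Qed.

(** The operator acting by [phi] on the factor [i] and by the identity on the others; meaningful
    when [phi] is linear. *)
Definition slot i (phi : V i -> V i) : tensor V -> tensor V :=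
  tensor_lift (fun v => pure_tensor (dfwith v (phi (v i)))).

Section SlotLinear.
Variables (i : I) (phi : {linear V i -> V i}).

Lemma slot_multilinear :
  multilinear (fun v => pure_tensor (dfwith v (phi (v i)))).
Proof.
move=> v j a x y /=; have [ij|ji] := eqVneq j i.
  by subst j; rewrite !dfwith_in !dfwith_idem linearP pure_tensor_multilinear.
rewrite !(dfwith_out _ _ ji) !(dfwithC _ _ _ ji).
by rewrite pure_tensor_multilinear.
Qed.

Lemma slot_pure v :
  slot phi (pure_tensor v) = pure_tensor (dfwith v (phi (v i))).
Proof. exact/tensor_lift_pure/slot_multilinear. Qed.

Lemma slot_is_linear : linear (slot phi).
Proof. exact/tensor_lift_is_linear/slot_multilinear. Qed.

HB.instance Definition _ :=
  GRing.isLinear.Build F (tensor V) (tensor V) _ (slot phi) slot_is_linear.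

End SlotLinear.

Lemma slot_id i (phi : {linear V i -> V i}) : phi =1 id -> slot phi =1 id.
Proof.
move=> e; elim/tensor_ind => [|a s t es et|v]; rewrite ?linear0 ?linearP //=.
  by rewrite es et.
by rewrite slot_pure e dfwith_id.
Qed.

Lemma slot_comp i (phi psi : {linear V i -> V i}) t :
  slot (phi \o psi) t = slot phi (slot psi t).
Proof.
elim/tensor_ind: t => [|a s t es et|v]; rewrite ?linear0 ?linearP //=.
  by rewrite es et.
by rewrite !slot_pure dfwith_in dfwith_idem.
Qed.

Lemma slotD i (phi psi : {linear V i -> V i}) t :
  slot (phi \+ psi) t = slot phi t + slot psi t.
Proof.
elim/tensor_ind: t => [|a s t es et|v].
- by rewrite !linear0 addr0.
- by rewrite !linearP /= es et scalerDr addrACA.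
have := pure_tensor_multilinear v 1 (phi (v i)) (psi (v i)).
by rewrite !slot_pure /= !scale1r.
Qed.

Lemma slotZ i a (phi : {linear V i -> V i}) t :
  slot (a \*: phi) t = a *: slot phi t.
Proof.
elim/tensor_ind: t => [|b s t es et|v].
- by rewrite !linear0.
- by rewrite !linearP /= es et.
have := pure_tensor_multilinear v a (phi (v i)) 0.
by rewrite !slot_pure /= pure_tensor0 !addr0.
Qed.

Lemma slot_comm i j (phi : {linear V i -> V i}) (psi : {linear V j -> V j}) t :
  i != j -> slot phi (slot psi t) = slot psi (slot phi t).
Proof.
move=> ij; elim/tensor_ind: t => [|a s t es et|v].
- by rewrite !linear0.
- by rewrite !linearP /= es et.
have ji : j != i by rewrite eq_sym.
by rewrite !slot_pure (dfwith_out _ _ ij) (dfwith_out _ _ ji) dfwithC.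
Qed.

(** A pure tensor is killed after as many steps as its entry [i], and a sum after the larger of two
    exponents. *)
Lemma slot_locally_nilpotent i (phi : {linear V i -> V i}) :
  (forall x, exists N, iter N phi x = 0) ->
  forall t, exists N, iter N (slot phi) t = 0.
Proof.
move=> nil; elim/tensor_ind => [|a s t [N es] [M et]|v].
- by exists 0%N.
- exists (maxn N M); have -> m : iter m (slot phi) (a *: s + t) =
      a *: iter m (slot phi) s + iter m (slot phi) t.
    by elim: m => //= m ->; rewrite linearP.
  rewrite (iter_linear_ge _ es) ?leq_maxl // (iter_linear_ge _ et) ?leq_maxr //.
  by rewrite scaler0 addr0.
have [N eN] := nil (v i); exists N.
have -> : iter N (slot phi) (pure_tensor v) =
    pure_tensor (dfwith v (iter N phi (v i))).
  elim: N {eN} => [|m /= ->]; last by rewrite slot_pure dfwith_in dfwith_idem.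
  by rewrite dfwith_id.
by rewrite eN pure_tensor0.
Qed.

End Slot.

(** * Reindexing the factors of a tensor power *)

Section TensorReindex.
Variables (F : fieldType) (I J : finType) (V : lmodType F).
Variables (tau : I -> J) (tau' : J -> I).
Hypotheses (tauK : cancel tau tau') (tau'K : cancel tau' tau).

Local Notation T K := (tensor (fun _ : K => V)).

(** The entry at [j] is read off at [tau' j], so that the factor [i] moves to the position
    [tau i]. *)
Definition tensor_reindex : T I -> T J :=
  tensor_lift (fun v : I -> V => pure_tensor (fun j : J => v (tau' j)) : T J).

Lemma dfwith_reindex (v : I -> V) i (x : V) :
  (fun j => @dfwith I (fun _ => V) v i x (tau' j)) =
  @dfwith J (fun _ => V) (fun j => v (tau' j)) (tau i) x.
Proof.
apply: functional_extensionality_dep => j.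
have [<-|ij] := eqVneq (tau i) j; first by rewrite tauK !dfwith_in.
rewrite !dfwith_out //; apply: contra_neq ij => ->; exact: tau'K.
Qed.

Lemma reindex_multilinear :
  multilinear (fun v : I -> V => pure_tensor (fun j : J => v (tau' j)) : T J).
Proof.
move=> v i a x y /=; rewrite !dfwith_reindex.
exact: (pure_tensor_multilinear (V := fun _ : J => V)).
Qed.

Lemma tensor_reindex_pure (v : I -> V) :
  tensor_reindex (pure_tensor v) = pure_tensor (fun j : J => v (tau' j)).
Proof. exact/tensor_lift_pure/reindex_multilinear. Qed.

Lemma tensor_reindex_is_linear : linear tensor_reindex.
Proof. exact/tensor_lift_is_linear/reindex_multilinear. Qed.

HB.instance Definition _ :=
  GRing.isLinear.Build F (T I) (T J) _ tensor_reindex tensor_reindex_is_linear.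

(** Linearity rests on [tauK] and [tau'K], which the map alone does not determine; hence the
    explicit linear structure. *)
Definition tensor_reindex_linear : {linear T I -> T J} := tensor_reindex.

Lemma tensor_reindex_slot i (phi : {linear V -> V}) t :
  tensor_reindex (slot (i := i) phi t) =
  slot (i := tau i) phi (tensor_reindex t).
Proof.
elim/tensor_ind: t => [|a s t es et|v].
- by rewrite !linear0.
- by rewrite !linearP /= es et.
rewrite !tensor_reindex_pure !slot_pure tensor_reindex_pure.
by rewrite dfwith_reindex tauK.
Qed.

End TensorReindex.

Lemma tensor_reindexK (F : fieldType) (I J : finType) (V : lmodType F)
    (tau : I -> J) (tau' : J -> I) : cancel tau tau' -> cancel tau' tau ->
  cancel (@tensor_reindex F I J V tau') (tensor_reindex tau).
Proof.
move=> tauK tau'K.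
pose f := tensor_reindex_linear V tauK tau'K.
pose g := tensor_reindex_linear V tau'K tauK.
apply: (eq_tensor_linear (f := g \o f) (g := idfun)) => v /=.
rewrite (tensor_reindex_pure tauK tau'K) (tensor_reindex_pure tau'K tauK).
congr pure_tensor; by apply: functional_extensionality_dep => k; rewrite tauK.
Qed.

(** * Operators on the polynomial modules *)

Section PolyOperators.
Variable F : fieldType.
Implicit Types (f p : poly_st F) (n : int) (q : {poly F}).

Local Notation s := ('X_ord0 : poly_st F).
Local Notation t := ('X_ord_max : poly_st F).
Local Notation D := (mderiv (R := F) (ord_max : 'I_2)).

Lemma shift_s_is_linear n : linear (@shift_s F n).
Proof. by move=> a u v; rewrite shift_sD shift_sZ. Qed.

HB.instance Definition _ n :=
  GRing.isLinear.Build F (poly_st F) (poly_st F) _ (@shift_s F n)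
    (shift_s_is_linear n).

Definition mul_by p f := p * f.

Lemma mul_by_is_linear p : linear (mul_by p).
Proof. by move=> a u v; rewrite /mul_by mulrDr scalerAr. Qed.

HB.instance Definition _ p :=
  GRing.isLinear.Build F (poly_st F) (poly_st F) _ (mul_by p)
    (mul_by_is_linear p).

(** Local nilpotency of this difference operator is what makes f(s - n, t) polynomial in n. *)
Definition diff_s f := shift_s 1 f - f.

Lemma diff_s_is_linear : linear diff_s.
Proof.
by move=> a u v; rewrite /diff_s linearP /= scalerBr opprD addrACA.
Qed.

HB.instance Definition _ :=
  GRing.isLinear.Build F (poly_st F) (poly_st F) _ diff_s diff_s_is_linear.

(** By the twisted product rule the elements killed by a power of [Delta] are closed under products,
    so the generators [s] and [t] suffice. *)
Lemma locally_nilpotent_st (Delta : {linear poly_st F -> poly_st F}) (e : F) :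
  (forall f h, Delta (f * h) =
     Delta f * h + f * Delta h + e *: (Delta f * Delta h)) ->
  (forall c, Delta c%:MP = 0) ->
  (exists N, iter N Delta s = 0) -> (exists N, iter N Delta t = 0) ->
  forall f, exists N, iter N Delta f = 0.
Proof.
move=> DM D0 Ds Dt.
elim/mpoly_st_ind => [c|||f h [N eN] [M eM]|f h [N eN] [M eM]] //.
- by exists 1%N; apply: D0.
- exists (maxn N M).
  have -> m : iter m Delta (f + h) = iter m Delta f + iter m Delta h.
    by elim: m => //= m ->; rewrite linearD.
  rewrite (iter_linear_ge _ eN) ?leq_maxl // (iter_linear_ge _ eM) ?leq_maxr //.
  by rewrite addr0.
- by exists (N + M)%N; apply: (locally_nilpotentM DM eN eM).
Qed.

Lemma mderiv_locally_nilpotent f : exists N, iter N D f = 0.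
Proof.
apply: (@locally_nilpotent_st _ 0) => [u v|c||].
- by rewrite scale0r addr0; apply: mderivM.
- exact: mderivC.
- by exists 1%N; apply: mderiv_s.
- by exists 2; rewrite /= mderiv_t; apply: mderivC.
Qed.

Lemma diff_s_locally_nilpotent f : exists N, iter N diff_s f = 0.
Proof.
apply: (@locally_nilpotent_st _ 1) => [u v|c||]; rewrite /diff_s.
- by rewrite /= /diff_s shift_sM scale1r; ring.
- by rewrite /= /diff_s shift_sC subrr.
- exists 2; rewrite /= /diff_s !shift_s_s.
  by rewrite addrAC subrr sub0r -mpolyCN shift_sC subrr.
- by exists 1%N; rewrite /= /diff_s shift_s_t subrr.
Qed.

Lemma poly_in_tD (q1 q2 : {poly F}) :
  poly_in_t (q1 + q2) = poly_in_t q1 + poly_in_t q2.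
Proof. exact: rmorphD. Qed.

Lemma poly_in_tM (q1 q2 : {poly F}) :
  poly_in_t (q1 * q2) = poly_in_t q1 * poly_in_t q2.
Proof. exact: rmorphM. Qed.

Lemma poly_in_tC (c : F) : poly_in_t c%:P = c%:MP.
Proof. by rewrite /poly_in_t horner_algC -mul_mpolyC mulr1. Qed.

Lemma poly_in_tX : poly_in_t ('X : {poly F}) = t.
Proof. exact: horner_algX. Qed.

Lemma mderiv_poly_in_t q : D (poly_in_t q) = poly_in_t q^`().
Proof.
elim/poly_ind: q => [|q c IH].
  by rewrite derivC -polyC0 poly_in_tC mderivC.
rewrite derivMXaddC !poly_in_tD !poly_in_tM poly_in_tX poly_in_tC.
rewrite mderivD mderivM mderivC mderiv_t IH; ring.
Qed.

End PolyOperators.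

Section TensorAct.
Variables (F : fieldType) (L : lieAlgebra F).

HB.instance Definition _ (V : lieModule L) (x : L) :=
  GRing.isLinear.Build F V V _ (@lie_act F L V x) (lie_actr x).

Lemma tensor_act_slot (I : finType) (V : I -> lieModule L) (x : L) u :
  tensor_act (V := V) x u = \sum_i slot (i := i) (@lie_act F L (V i) x) u.
Proof.
elim/tensor_ind: u => [|a s t es et|v].
- by rewrite linear0 big1 // => i _; rewrite linear0.
- rewrite tensor_actr es et scaler_sumr -big_split.
  by apply: eq_bigr => i _; rewrite linearP.
by rewrite tensor_act_pure; apply: eq_bigr => i _; rewrite slot_pure.
Qed.

End TensorAct.


HB.instance Definition _ (F : fieldType) (alpha beta gamma lambda : F)
    (g : {poly F}) (x : WH4 F) :=
  GRing.isLinear.Build F (poly_st F) (poly_st F) _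
    (omega_act alpha beta gamma lambda g x)
    (omega_actr alpha beta gamma lambda g x).

(** * Tensor powers of the polynomial space *)

Section TensorPoly.
Variables (F : fieldType) (I : finType).

Local Notation factor := (fun _ : I => (poly_st F : lmodType F)).

(** The common underlying space of all tensor products of modules [Omega] indexed by [I]; the
    parameters enter only through the action. *)
Definition poly_tensor : lmodType F := tensor factor.

Local Notation s := ('X_ord0 : poly_st F).
Local Notation t := ('X_ord_max : poly_st F).
Local Notation D := (mderiv (R := F) (ord_max : 'I_2)).

Definition slot_st (i : I) (phi : poly_st F -> poly_st F) :
  poly_tensor -> poly_tensor := slot (V := factor) (i := i) phi.

HB.instance Definition _ i (phi : {linear poly_st F -> poly_st F}) :=
  GRing.Linear.on (slot_st i phi).

Implicit Types (i : I) (u : poly_tensor) (n : nat).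

Lemma eq_slot_st i phi psi u : phi =1 psi -> slot_st i phi u = slot_st i psi u.
Proof. by move=> e; congr slot_st; apply: functional_extensionality_dep. Qed.

Lemma slot_stM i (phi psi : {linear poly_st F -> poly_st F}) u :
  slot_st i (phi \o psi) u = slot_st i phi (slot_st i psi u).
Proof. exact: slot_comp. Qed.

Lemma slot_stD i (phi psi : {linear poly_st F -> poly_st F}) u :
  slot_st i (phi \+ psi) u = slot_st i phi u + slot_st i psi u.
Proof. exact: slotD. Qed.

Lemma slot_stZ i a (phi : {linear poly_st F -> poly_st F}) u :
  slot_st i (a \*: phi) u = a *: slot_st i phi u.
Proof. exact: slotZ. Qed.

Lemma slot_stC i j (phi psi : {linear poly_st F -> poly_st F}) u : i != j ->
  slot_st i phi (slot_st j psi u) = slot_st j psi (slot_st i phi u).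
Proof. exact: slot_comm. Qed.

Definition shift_at i n := slot_st i (@shift_s F n).
Definition s_at i := slot_st i (mul_by s).
Definition poly_at i q := slot_st i (mul_by (poly_in_t q)).
Definition dt_at i := slot_st i D.

HB.instance Definition _ i n := GRing.Linear.on (shift_at i n).
HB.instance Definition _ i := GRing.Linear.on (s_at i).
HB.instance Definition _ i q := GRing.Linear.on (poly_at i q).
HB.instance Definition _ i := GRing.Linear.on (dt_at i).

Section BasisAction.
Variables (alpha beta gamma lambda : F) (g : {poly F}).
Local Notation act := (omega_basis_act alpha beta gamma lambda g).

(** For degrees [n >= 0], this and the next four lemmas factor out [lambda ^+ n]. What remains
    depends on [n] only through the shift and, for L_n, through [n%:R * alpha]. *)
Lemma slot_actL i n u : slot_st i (act (BasisL n)) u =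
  lambda ^+ n *: (s_at i (shift_at i n u) + (n%:R * alpha) *: shift_at i n u).
Proof.
rewrite /shift_at /s_at -slot_stM -slot_stZ -slot_stD -slot_stZ.
apply: eq_slot_st => f /=.
by rewrite mulrDl mul_mpolyC.
Qed.

Lemma slot_acta i n u : slot_st i (act (BasisH H4a n)) u =
  lambda ^+ n *: poly_at i 'X (shift_at i n u).
Proof.
rewrite /shift_at /poly_at -slot_stM -slot_stZ; apply: eq_slot_st => f /=.
by rewrite /mul_by poly_in_tX.
Qed.

Lemma slot_actb i n u : slot_st i (act (BasisH H4b n)) u =
  lambda ^+ n *:
    (poly_at i g (shift_at i n u) + beta *: dt_at i (shift_at i n u)).
Proof.
rewrite /shift_at /poly_at /dt_at -!slot_stM -slot_stZ -slot_stD -slot_stZ.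
apply: eq_slot_st => f /=.
by rewrite scalerDr scalerA.
Qed.

Lemma slot_actc i n u : slot_st i (act (BasisH H4c n)) u =
  lambda ^+ n *: (- beta *: shift_at i n u).
Proof.
rewrite /shift_at -!slot_stZ; apply: eq_slot_st => f /=.
by rewrite scalerA mulrN.
Qed.

Lemma slot_actd i n u : slot_st i (act (BasisH H4d n)) u =
  lambda ^+ n *: (beta^-1 *: (poly_at i ('X * g) (shift_at i n u)
                              + gamma *: shift_at i n u)
                  + poly_at i 'X (dt_at i (shift_at i n u))).
Proof.
rewrite /shift_at /poly_at /dt_at.
rewrite -!slot_stM -slot_stZ -slot_stD -slot_stZ -slot_stD -slot_stZ.
apply: eq_slot_st => f /=.
rewrite /mul_by poly_in_tM poly_in_tX scalerDr scalerA; congr (_ *: _ + _).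
by rewrite mulrDl mul_mpolyC.
Qed.

End BasisAction.

Lemma shift_at0 i u : shift_at i 0 u = u.
Proof.
apply: (@slot_id _ _ factor i (@shift_s F 0)) => f /=.
elim/mpoly_st_ind: f => [c|||f h ef eh|f h ef eh].
- by rewrite shift_sC.
- by rewrite shift_s_s mpolyC0 subr0.
- by rewrite shift_s_t.
- by rewrite shift_sD ef eh.
- by rewrite shift_sM ef eh.
Qed.

(** Reduces the dependence of the shifts on [n] to the locally nilpotent [diff_s]. *)
Lemma shift_at_diff i n u :
  shift_at i n.+1 u - shift_at i n u = shift_at i n (slot_st i (@diff_s F) u).
Proof.
rewrite /shift_at -slot_stM -[X in _ + X]scaleN1r -slot_stZ -slot_stD.
apply: eq_slot_st => f /=.
by rewrite /diff_s scaleN1r linearB /= shift_s_shift -PoszD addn1.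
Qed.

Lemma diff_at_locally_nilpotent i u :
  exists N, iter N (slot_st i (@diff_s F)) u = 0.
Proof.
exact: (slot_locally_nilpotent (i := i) (@diff_s_locally_nilpotent F) u).
Qed.

Lemma poly_atC i c u : poly_at i c%:P u = c *: u.
Proof.
have -> : u = slot_st i idfun u by rewrite [RHS]slot_id.
rewrite -slot_stZ /poly_at -slot_stM; apply: eq_slot_st => f /=.
by rewrite /mul_by poly_in_tC mul_mpolyC.
Qed.

Lemma poly_atD i q1 q2 u :
  poly_at i (q1 + q2) u = poly_at i q1 u + poly_at i q2 u.
Proof.
rewrite /poly_at -slot_stD; apply: eq_slot_st => f /=.
by rewrite /mul_by poly_in_tD mulrDl.
Qed.

Lemma poly_atM i q1 q2 u :
  poly_at i (q1 * q2) u = poly_at i q1 (poly_at i q2 u).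
Proof.
rewrite /poly_at -slot_stM; apply: eq_slot_st => f /=.
by rewrite /mul_by poly_in_tM mulrA.
Qed.

Lemma dt_poly_at i q u :
  dt_at i (poly_at i q u) = poly_at i q^`() u + poly_at i q (dt_at i u).
Proof.
rewrite /dt_at /poly_at -!slot_stM -slot_stD; apply: eq_slot_st => f /=.
by rewrite /mul_by mderivM mderiv_poly_in_t.
Qed.

Lemma dt_at_locally_nilpotent i u : exists N, iter N (dt_at i) u = 0.
Proof.
exact: (slot_locally_nilpotent (i := i) (@mderiv_locally_nilpotent F) u).
Qed.

(** Shifts touch only the variables s_j, so they commute with multiplication by q(t_i). *)
Lemma shift_at_poly_at i q u : (forall j n, shift_at j n u = u) ->
  forall j n, shift_at j n (poly_at i q u) = poly_at i q u.
Proof.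
move=> fu j n; have [->|ij] := eqVneq j i; last first.
  by rewrite /shift_at /poly_at slot_stC // [slot_st j _ u]fu.
rewrite -[in RHS](fu i n) /shift_at /poly_at -!slot_stM.
apply: eq_slot_st => f /=.
by rewrite /mul_by shift_sM shift_s_g.
Qed.

Definition tensor_one : poly_tensor := pure_tensor (fun _ : I => 1).

Lemma shift_at_one i n : shift_at i n tensor_one = tensor_one.
Proof.
rewrite /shift_at /slot_st slot_pure /=.
have -> : shift_s n (1 : poly_st F) = 1 by rewrite -mpolyC1 shift_sC.
by rewrite (dfwith_id (fun _ : I => (1 : poly_st F))).
Qed.

Lemma dt_at_one i : dt_at i tensor_one = 0.
Proof.
rewrite /dt_at /slot_st slot_pure /=.
have -> : D (1 : poly_st F) = 0 by rewrite -mpolyC1 mderivC.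
by rewrite pure_tensor0.
Qed.

(** The product of the constant coefficients is multilinear, hence induces a linear form on the
    tensor product; its value at [tensor_one] is 1. *)
Lemma tensor_one_neq0 : tensor_one != 0.
Proof.
pose phi (v : I -> poly_st F) : F^o := \prod_i (v i)@_0.
have phi_lin : multilinear (V := factor) phi.
  move=> v i a x y; rewrite /phi (bigD1 i) //= dfwith_in.
  rewrite [in RHS](bigD1 i) //= [X in _ = _ + X](bigD1 i) //= !dfwith_in.
  have E (z : poly_st F) :
      \prod_(j | j != i) (@dfwith I (fun _ => poly_st F) v i z j)@_0 =
      \prod_(j | j != i) (v j)@_0.
    by apply: eq_bigr => j; rewrite eq_sym => ij; rewrite dfwith_out.
  by rewrite !E mcoeffD mcoeffZ mulrDl scalerAl.
apply/eqP => /(congr1 (tensor_lift phi)).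
rewrite tensor_lift_pure //; have -> : tensor_lift phi 0 = 0.
  have := tensor_lift_is_linear phi_lin (-1) 0 0.
  by rewrite scaler0 addr0 scaleN1r addNr.
rewrite /phi big1 => [/eqP|i _]; first by rewrite oner_eq0.
by rewrite mcoeff1 eqxx.
Qed.

Variables (alpha beta gamma lambda : I -> F) (g : I -> {poly F}).
Hypotheses (beta0 : forall i, beta i != 0) (lambda0 : forall i, lambda i != 0).

Local Notation VO := (fun i =>
  Omega (alpha i) (beta i) (gamma i) (lambda i) (g i) (beta0 i) (lambda0 i)).

Lemma omega_tensor_act (x : WH4 F) (u : poly_tensor) :
  tensor_act (V := VO) x u =
  \sum_i slot_st i
    (omega_act (alpha i) (beta i) (gamma i) (lambda i) (g i) x) u.
Proof. exact: tensor_act_slot. Qed.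

Lemma omega_tensor_actU e (u : poly_tensor) :
  tensor_act (V := VO) << e >> u =
  \sum_i slot_st i
    (omega_basis_act (alpha i) (beta i) (gamma i) (lambda i) (g i) e) u.
Proof.
rewrite omega_tensor_act; apply: eq_bigr => i _.
by apply: eq_slot_st => f; apply: omega_actU.
Qed.

End TensorPoly.

(** * Rigidity of the parameters *)

(* The rigidity argument uses only the following operators on
   C[s_i, t_i | i in I]: st_shift i n is f |-> f(s_i - n), st_s i is
   multiplication by s_i, st_t i q is multiplication by q(t_i), and st_dt i is
   the derivative in t_i. *)
Record st_operators (F : fieldType) (I : finType) (W : lmodType F) := {
  st_shift : I -> nat -> {linear W -> W};
  st_diff : I -> {linear W -> W};
  st_s : I -> {linear W -> W};
  st_t : I -> {poly F} -> {linear W -> W};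
  st_dt : I -> {linear W -> W};
  st_one : W;
  st_shift0 : forall i u, st_shift i 0 u = u;
  st_shiftB : forall i n u,
    st_shift i n.+1 u - st_shift i n u = st_shift i n (st_diff i u);
  st_diff_nilpotent : forall i u, exists N, iter N (st_diff i) u = 0;
  st_tC : forall i c u, st_t i c%:P u = c *: u;
  st_tD : forall i p q u, st_t i (p + q) u = st_t i p u + st_t i q u;
  st_tM : forall i p q u, st_t i (p * q) u = st_t i p (st_t i q u);
  st_dt_t : forall i q u,
    st_dt i (st_t i q u) = st_t i q^`() u + st_t i q (st_dt i u);
  st_dt_nilpotent : forall i u, exists N, iter N (st_dt i) u = 0;
  st_shift_t : forall i q u, (forall j n, st_shift j n u = u) ->
    forall j n, st_shift j n (st_t i q u) = st_t i q u;
  st_shift_one : forall j n, st_shift j n st_one = st_one;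
  st_dt_one : forall i, st_dt i st_one = 0;
  st_one_neq0 : st_one != 0 }.

Section StOperatorsTheory.
Variables (F : numFieldType) (I : finType) (W : lmodType F).
Variable O : st_operators I W.
Implicit Types (i : I) (u w : W) (p q : {poly F}).

(** In characteristic zero, a polynomial fixed by these shifts contains no variable s_i. *)
Definition s_free u := forall i n, st_shift O i n u = u.

(** Induction on the number of differences that kill [u]: the operator ['X - c%:P] replaces [u] by
    [st_diff O i u], up to the factor [c]. *)
Lemma gen_eigenseq_shift i c a u :
  gen_eigenseq c (fun n => c ^+ n *: (a *: st_shift O i n u)).
Proof.
have [N] := st_diff_nilpotent O i u.
elim: N u => [|N IH] u.
  by move=> /= ->; apply: gen_eigenseq0 => n; rewrite linear0 !scaler0.
rewrite iterSr => /IH gd; apply: gen_eigenseq_step.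
apply/(eq_gen_eigenseq _ (gen_eigenseqZ c gd)) => n.
by rewrite -st_shiftB !scalerBr exprS !scalerA.
Qed.

(** Differentiating q(t) w = 0 gives q'(t) w = 0, as the other term p(t) q(t) w vanishes. By
    induction on the degree q' = 0, so q is constant in characteristic zero, and w != 0 makes it
    zero. *)
Lemma st_t_injective i w q : w != 0 ->
  (exists p, st_dt O i w = st_t O i p w) -> st_t O i q w = 0 -> q = 0.
Proof.
move=> w0 [p ew]; elim: {q}(size q) {-2}q (leqnn (size q)) => [|m IH] q.
  by rewrite leqn0 size_poly_eq0 => /eqP.
move=> szq qw; have [//|q0] := eqVneq q 0.
have dq0 : q^`() = 0.
  apply: IH; first by rewrite -ltnS (leq_trans _ szq) // lt_size_deriv.
  have := st_dt_t O i q w; rewrite qw linear0 ew -st_tM mulrC st_tM qw linear0.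
  by rewrite addr0 => ->.
have eq : q = (q`_0)%:P.
  apply/polyP => -[|k]; rewrite coefC //=.
  have /eqP := congr1 (fun r : {poly F} => r`_k) dq0.
  by rewrite coef_deriv coef0 Num.Theory.mulrn_eq0 /= => /eqP.
move: qw; rewrite eq st_tC => /eqP; rewrite scaler_eq0 (negPf w0) orbF.
by move=> /eqP->; rewrite polyC0.
Qed.

(* If d w = p(t) w, then d^n w = (r n)(t) w for the sequence r below, which
   never vanishes when p is nonzero; so d is not nilpotent at w. *)
Lemma st_dt_eigenvector i w p : w != 0 -> st_dt O i w = st_t O i p w -> p = 0.
Proof.
move=> w0 ew; apply/eqP; apply: contraT => p0.
pose r := fix r n := if n is m.+1 then (r m)^`() + r m * p else 1.
have r0 n : r n != 0.
  elim: n => [|n IH]; first exact: oner_neq0.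
  (* The derivative is smaller in size than [r n], hence than [r n * p], so the leading terms cannot
     cancel. *)
  rewrite -size_poly_gt0 /= addrC size_polyDl ?size_poly_gt0 ?mulf_neq0 //.
  apply: (leq_trans (lt_size_deriv IH)); rewrite size_mul //.
  by rewrite -subn1 -addnBA ?size_poly_gt0 // leq_addr.
have rw n : iter n (st_dt O i) w = st_t O i (r n) w.
  elim: n => [|n /= ->]; first by have := st_tC O i 1 w; rewrite polyC1 scale1r.
  by rewrite st_dt_t ew -st_tM -st_tD.
have [N] := st_dt_nilpotent O i w; rewrite rw => rNw.
by have := r0 N; rewrite (@st_t_injective i w (r N)) ?eqxx //; exists p.
Qed.

End StOperatorsTheory.

(** * Parameters recovered from an injective intertwining map *)

Section Rigidity.
Variables (F : numFieldType) (I J : finType) (W W' : lmodType F).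
Variables (O : st_operators I W) (O' : st_operators J W').
Variables (alpha beta gamma lambda : I -> F) (g : I -> {poly F}).
Variables (xi epsilon omega mu : J -> F) (h : J -> {poly F}).
Hypotheses (beta0 : forall i, beta i != 0).
Hypotheses (epsilon0 : forall j, epsilon j != 0).
Hypothesis mu0 : forall j, mu j != 0.
Hypotheses (lambda_inj : injective lambda) (mu_inj : injective mu).
Variables (f : {linear W -> W'}).
Hypothesis f_inj : forall u, f u = 0 -> u = 0.

Local Notation sh := (st_shift O).
Local Notation sh' := (st_shift O').
Local Notation t := (st_t O).
Local Notation t' := (st_t O').

Hypothesis fL : forall n u,
  f (\sum_i lambda i ^+ n *:
       (st_s O i (sh i n u) + (n%:R * alpha i) *: sh i n u))
  = \sum_j mu j ^+ n *:
      (st_s O' j (sh' j n (f u)) + (n%:R * xi j) *: sh' j n (f u)).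
Hypothesis fa : forall n u,
  f (\sum_i lambda i ^+ n *: t i 'X (sh i n u))
  = \sum_j mu j ^+ n *: t' j 'X (sh' j n (f u)).
Hypothesis fb : forall n u,
  f (\sum_i lambda i ^+ n *:
       (t i (g i) (sh i n u) + beta i *: st_dt O i (sh i n u)))
  = \sum_j mu j ^+ n *:
      (t' j (h j) (sh' j n (f u)) + epsilon j *: st_dt O' j (sh' j n (f u))).
Hypothesis fc : forall n u,
  f (\sum_i lambda i ^+ n *: (- beta i *: sh i n u))
  = \sum_j mu j ^+ n *: (- epsilon j *: sh' j n (f u)).
Hypothesis fd : forall n u,
  f (\sum_i lambda i ^+ n *:
       ((beta i)^-1 *: (t i ('X * g i) (sh i n u) + gamma i *: sh i n u)
        + t i 'X (st_dt O i (sh i n u))))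
  = \sum_j mu j ^+ n *:
      ((epsilon j)^-1 *:
         (t' j ('X * h j) (sh' j n (f u)) + omega j *: sh' j n (f u))
        + t' j 'X (st_dt O' j (sh' j n (f u)))).

Local Notation w := (f (st_one O)).

Let fZ a u : f (a *: u) = a *: f u. Proof. exact: linearZ. Qed.

Lemma image_one_neq0 : w != 0.
Proof. by apply: contra_neq (st_one_neq0 O) => /f_inj. Qed.

(** The identity [fc] split by eigenvalue. The shifts stay on the right until [f u] is known to be
    [s_free]. *)
Lemma image_s_freeP u : s_free O u -> forall c n,
  \sum_(i | lambda i == c) lambda i ^+ n *: (- beta i *: f u) =
  \sum_(j | mu j == c) mu j ^+ n *: (- epsilon j *: sh' j n (f u)).
Proof.
move=> fu; apply: gen_eigenseq_match => [i|j|n].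
- exact: gen_eigenseq_expr.
- exact: gen_eigenseq_shift.
rewrite -fc linear_sum; apply: eq_bigr => i _.
by rewrite fu !fZ.
Qed.

(** Otherwise the right side for the eigenvalue [lambda i] is an empty sum, which leaves
    [- beta i *: w = 0]. *)
Lemma exists_mu i : exists j, lambda i = mu j.
Proof.
have := @image_s_freeP _ (@st_shift_one _ _ _ O) (lambda i) 0.
rewrite (big_pred1 i) => [|k]; last by rewrite (inj_eq lambda_inj).
case: (pickP (fun j => mu j == lambda i)) => [j /eqP e _|none].
  by exists j.
rewrite big_pred0 // expr0 scale1r => /eqP; rewrite scaler_eq0 oppr_eq0.
by rewrite (negPf (beta0 i)) (negPf image_one_neq0).
Qed.

Lemma exists_lambda j : exists i, lambda i = mu j.
Proof.
have := @image_s_freeP _ (@st_shift_one _ _ _ O) (mu j) 0.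
rewrite [in RHS](big_pred1 j) => [|k]; last by rewrite (inj_eq mu_inj).
case: (pickP (fun i => lambda i == mu j)) => [i /eqP e _|none].
  by exists i.
rewrite big_pred0 // expr0 scale1r st_shift0 => /esym/eqP.
rewrite scaler_eq0 oppr_eq0.
by rewrite (negPf (epsilon0 j)) (negPf image_one_neq0).
Qed.

Lemma beta_epsilon i j : lambda i = mu j -> beta i = epsilon j.
Proof.
move=> e; have := @image_s_freeP _ (@st_shift_one _ _ _ O) (lambda i) 0.
rewrite (big_pred1 i) => [|k]; last by rewrite (inj_eq lambda_inj).
rewrite (big_pred1 j) => [|k]; last by rewrite e (inj_eq mu_inj).
rewrite !expr0 !scale1r st_shift0 => /eqP.
rewrite -subr_eq0 -scalerBl scaler_eq0 (negPf image_one_neq0) orbF subr_eq0.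
by move=> /eqP/oppr_inj.
Qed.

(** Every [j] has a matching [i], for which [beta i = epsilon j]. Cancelling the nonzero scalar in
    the identity from c_n leaves exactly the invariance of [f u] under the shifts at [j]. *)
Lemma image_s_free u : s_free O u -> s_free O' (f u).
Proof.
move=> fu j n; have [i e] := exists_lambda j.
have := image_s_freeP fu (lambda i) n.
rewrite (big_pred1 i) => [|k]; last by rewrite (inj_eq lambda_inj).
rewrite (big_pred1 j) => [|k]; last by rewrite e (inj_eq mu_inj).
have nz : mu j ^+ n * - epsilon j != 0.
  by rewrite mulf_neq0 ?oppr_eq0 ?expf_neq0.
by rewrite e (beta_epsilon e) !scalerA => /(scalerI nz).
Qed.

(** Separation when [n] enters only through the powers; the matched terms are compared at
    [n = 0]. *)
Lemma expr_match i j (x : I -> W) (y : J -> W') : lambda i = mu j ->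
  (forall n, f (\sum_i lambda i ^+ n *: x i) = \sum_j mu j ^+ n *: y j) ->
  f (x i) = y j.
Proof.
move=> e exy.
have := @gen_eigenseq_match _ _ _ _ lambda mu
  (fun i n => lambda i ^+ n *: f (x i)) (fun j n => mu j ^+ n *: y j) _ _ _
  (lambda i) 0.
rewrite (big_pred1 i) => [|k]; last by rewrite (inj_eq lambda_inj).
rewrite (big_pred1 j) => [|k]; last by rewrite e (inj_eq mu_inj).
rewrite !expr0 !scale1r; apply=> [k|k|n]; try exact: gen_eigenseq_expr.
by rewrite -exy linear_sum; apply: eq_bigr => k _; rewrite fZ.
Qed.

Section Matching.
Variables (i : I) (j : J).
Hypothesis e : lambda i = mu j.

Lemma image_tX u : s_free O u -> f (t i 'X u) = t' j 'X (f u).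
Proof.
move=> fu; apply: (expr_match (x := fun i => t i 'X u)
  (y := fun j => t' j 'X (f u)) e) => n.
transitivity (f (\sum_i lambda i ^+ n *: t i 'X (sh i n u))).
  by congr (f _); apply: eq_bigr => k _; rewrite fu.
by rewrite fa; apply: eq_bigr => k _; rewrite image_s_free.
Qed.

(** Induction on [q], one factor ['X] at a time; the induction hypothesis applies to [t i 'X u]
    because it is again [s_free]. *)
Lemma image_t q u : s_free O u -> f (t i q u) = t' j q (f u).
Proof.
elim/poly_ind: q u => [|q c IH] u fu.
  by rewrite -polyC0 !st_tC !scale0r linear0.
rewrite !st_tD !st_tM !st_tC linearD fZ -image_tX // IH //.
exact: st_shift_t.
Qed.

(** Each factor contributes a power times an affine function of [n], so two values are compared:
    [n = 0] identifies the terms with [st_s], and [n = 1] the multiples of [w]. *)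
Lemma alpha_xi : alpha i = xi j.
Proof.
have fo := @st_shift_one _ _ _ O; have fw := image_s_free fo.
pose x i n :=
  lambda i ^+ n *: (f (st_s O i (st_one O)) + n%:R *: (alpha i *: w)).
pose y j n := mu j ^+ n *: (st_s O' j w + n%:R *: (xi j *: w)).
have ge c u (v : W') : gen_eigenseq c (fun n => c ^+ n *: (u + n%:R *: v)).
  apply/(eq_gen_eigenseq _ (gen_eigenseqD (gen_eigenseq_expr c u)
                                          (gen_eigenseq_exprn c v))) => n.
  by rewrite scalerDr.
have xy n : \sum_i x i n = \sum_j y j n.
  have := fL n (st_one O); rewrite linear_sum /= => fLn.
  transitivity (\sum_j mu j ^+ n *:
      (st_s O' j (sh' j n w) + (n%:R * xi j) *: sh' j n w)).
    rewrite -fLn; apply: eq_bigr => k _.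
    by rewrite fZ linearD fZ fo /x scalerA.
  by apply: eq_bigr => k _; rewrite fw /y scalerA.
have m n : x i n = y j n.
  have := gen_eigenseq_match (fun k => ge (lambda k) _ _)
    (fun k => ge (mu k) _ _) xy (lambda i) n.
  rewrite (big_pred1 i) => [|k]; last by rewrite (inj_eq lambda_inj).
  by rewrite (big_pred1 j) => [|k]; last by rewrite e (inj_eq mu_inj).
have := m 0; rewrite /x /y !expr0 !scale0r !scale1r !addr0 => es.
have := m 1; rewrite /x /y es e !expr1 !scale1r.
move=> /(scalerI (mu0 j)) /addrI /eqP.
rewrite -subr_eq0 -scalerBl scaler_eq0 (negPf image_one_neq0) orbF subr_eq0.
by move/eqP.
Qed.

(** As [st_dt] kills [st_one], only g_i(t_i) remains in b_n 1, and [image_t] carries it to t_j. *)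
Lemma image_b : t' j (g i) w = t' j (h j) w + epsilon j *: st_dt O' j w.
Proof.
have fo := @st_shift_one _ _ _ O; have fw := image_s_free fo.
rewrite -image_t //.
apply: (expr_match (x := fun i => t i (g i) (st_one O))
  (y := fun j => t' j (h j) w + epsilon j *: st_dt O' j w) e) => n.
transitivity (f (\sum_i lambda i ^+ n *: (t i (g i) (sh i n (st_one O))
                  + beta i *: st_dt O i (sh i n (st_one O))))).
  by congr (f _); apply: eq_bigr => k _; rewrite fo st_dt_one scaler0 addr0.
by rewrite fb; apply: eq_bigr => k _; rewrite fw.
Qed.

Lemma image_d : (beta i)^-1 *: (t' j ('X * g i) w + gamma i *: w) =
  (epsilon j)^-1 *: (t' j ('X * h j) w + omega j *: w)
    + t' j 'X (st_dt O' j w).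
Proof.
have fo := @st_shift_one _ _ _ O; have fw := image_s_free fo.
rewrite -image_t // -fZ -linearD -fZ.
apply: (expr_match (x := fun i => (beta i)^-1 *:
    (t i ('X * g i) (st_one O) + gamma i *: st_one O))
  (y := fun j => (epsilon j)^-1 *: (t' j ('X * h j) w + omega j *: w)
    + t' j 'X (st_dt O' j w)) e) => n.
transitivity (f (\sum_i lambda i ^+ n *:
    ((beta i)^-1 *: (t i ('X * g i) (sh i n (st_one O))
                     + gamma i *: sh i n (st_one O))
     + t i 'X (st_dt O i (sh i n (st_one O)))))).
  by congr (f _); apply: eq_bigr => k _; rewrite fo st_dt_one linear0 addr0.
by rewrite fd; apply: eq_bigr => k _; rewrite fw.
Qed.

(** By [image_b], the derivative of [w] is [t' j p w], and [st_dt_eigenvector] forces [p = 0]. *)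
Lemma g_h : g i = h j.
Proof.
pose p := (epsilon j)^-1%:P * (g i - h j).
have : st_dt O' j w = t' j p w.
  have tB : t' j (g i - h j) w = epsilon j *: st_dt O' j w.
    by rewrite -[X in X = _](addKr (t' j (h j) w)) -st_tD subrKC image_b addKr.
  by rewrite st_tM st_tC tB scalerA mulVf // scale1r.
move=> /(st_dt_eigenvector image_one_neq0) /eqP; rewrite mulf_eq0 polyC_eq0.
by rewrite invr_eq0 (negPf (epsilon0 j)) /= subr_eq0 => /eqP.
Qed.

(** Once [g i = h j], [image_b] gives dw/dt_j = 0, and [image_d] reduces to a comparison of
    multiples of [w]. *)
Lemma gamma_omega : gamma i = omega j.
Proof.
have dw : st_dt O' j w = 0.
  have /eqP := image_b; rewrite g_h eq_sym -subr_eq0 addrC addKr scaler_eq0.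
  by rewrite (negPf (epsilon0 j)) => /eqP.
have := image_d; rewrite dw linear0 addr0 g_h (beta_epsilon e).
have nz : (epsilon j)^-1 != 0 by rewrite invr_eq0.
move=> /(scalerI nz) /addrI /eqP.
rewrite -subr_eq0 -scalerBl scaler_eq0 (negPf image_one_neq0) orbF subr_eq0.
by move/eqP.
Qed.

End Matching.
End Rigidity.

Definition poly_operators (F : fieldType) (I : finType) :
    st_operators I (poly_tensor F I) :=
  @Build_st_operators F I (poly_tensor F I)
    (fun i n => shift_at i n) (fun i => slot_st i (@diff_s F)) (fun i => s_at i)
    (fun i q => poly_at i q) (fun i => dt_at i) (tensor_one F I)
    (@shift_at0 F I) (@shift_at_diff F I) (@diff_at_locally_nilpotent F I)
    (@poly_atC F I) (@poly_atD F I) (@poly_atM F I) (@dt_poly_at F I)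
    (@dt_at_locally_nilpotent F I) (@shift_at_poly_at F I) (@shift_at_one F I)
    (@dt_at_one F I) (@tensor_one_neq0 F I).

(** * Isomorphisms between tensor products of the modules [Omega] *)

Section OmegaIso.
Variables (F : numFieldType) (I J : finType).
Variables (alpha beta gamma lambda : I -> F) (g : I -> {poly F}).
Variables (xi epsilon omega mu : J -> F) (h : J -> {poly F}).
Hypotheses (beta0 : forall i, beta i != 0) (lambda0 : forall i, lambda i != 0).
Hypotheses (epsilon0 : forall j, epsilon j != 0) (mu0 : forall j, mu j != 0).

Local Notation VO := (fun i =>
  Omega (alpha i) (beta i) (gamma i) (lambda i) (g i) (beta0 i) (lambda0 i)).
Local Notation WO := (fun j =>
  Omega (xi j) (epsilon j) (omega j) (mu j) (h j) (epsilon0 j) (mu0 j)).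
Local Notation V := (tensor_module VO).
Local Notation W := (tensor_module WO).

(** The first conclusion serves to bound the number of factors of the second product by that of the
    first. *)
Lemma omega_tensor_iso_params : injective lambda -> injective mu ->
  lieModule_iso V W ->
  (forall j, exists i, lambda i = mu j) /\
  (forall i, exists j, [/\ alpha i = xi j, beta i = epsilon j,
     gamma i = omega j, lambda i = mu j & g i = h j]).
Proof.
move=> lambda_inj mu_inj [f [/bij_inj f_inj fact]].
pose f' : {linear poly_tensor F I -> poly_tensor F J} := f.
have f'0 u : f' u = 0 -> u = 0 by move=> fu; apply: f_inj; rewrite linear0.
(* Equivariance at a basis vector [e]; the five kinds of [e] give the five identities of the
   rigidity argument. *)
have fe e u :
    f' (\sum_i slot_st i
      (omega_basis_act (alpha i) (beta i) (gamma i) (lambda i) (g i) e) u) =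
    \sum_j slot_st j
      (omega_basis_act (xi j) (epsilon j) (omega j) (mu j) (h j) e) (f' u).
  rewrite -(omega_tensor_actU alpha gamma g beta0 lambda0).
  rewrite -(omega_tensor_actU xi omega h epsilon0 mu0).
  exact: fact.
pose O := poly_operators F I; pose O' := poly_operators F J.
have fL n u : f' (\sum_i lambda i ^+ n *:
      (st_s O i (st_shift O i n u) + (n%:R * alpha i) *: st_shift O i n u)) =
    \sum_j mu j ^+ n *:
      (st_s O' j (st_shift O' j n (f' u))
       + (n%:R * xi j) *: st_shift O' j n (f' u)).
  have := fe (BasisL n) u.
  under eq_bigr do rewrite slot_actL.
  under [in RHS]eq_bigr do rewrite slot_actL.
  exact.
have fa n u : f' (\sum_i lambda i ^+ n *: st_t O i 'X (st_shift O i n u)) =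
    \sum_j mu j ^+ n *: st_t O' j 'X (st_shift O' j n (f' u)).
  have := fe (BasisH H4a n) u.
  under eq_bigr do rewrite slot_acta.
  under [in RHS]eq_bigr do rewrite slot_acta.
  exact.
have fb n u : f' (\sum_i lambda i ^+ n *: (st_t O i (g i) (st_shift O i n u)
      + beta i *: st_dt O i (st_shift O i n u))) =
    \sum_j mu j ^+ n *: (st_t O' j (h j) (st_shift O' j n (f' u))
      + epsilon j *: st_dt O' j (st_shift O' j n (f' u))).
  have := fe (BasisH H4b n) u.
  under eq_bigr do rewrite slot_actb.
  under [in RHS]eq_bigr do rewrite slot_actb.
  exact.
have fc n u : f' (\sum_i lambda i ^+ n *: (- beta i *: st_shift O i n u)) =
    \sum_j mu j ^+ n *: (- epsilon j *: st_shift O' j n (f' u)).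
  have := fe (BasisH H4c n) u.
  under eq_bigr do rewrite slot_actc.
  under [in RHS]eq_bigr do rewrite slot_actc.
  exact.
have fd n u : f' (\sum_i lambda i ^+ n *:
      ((beta i)^-1 *: (st_t O i ('X * g i) (st_shift O i n u)
                       + gamma i *: st_shift O i n u)
       + st_t O i 'X (st_dt O i (st_shift O i n u)))) =
    \sum_j mu j ^+ n *:
      ((epsilon j)^-1 *: (st_t O' j ('X * h j) (st_shift O' j n (f' u))
                          + omega j *: st_shift O' j n (f' u))
       + st_t O' j 'X (st_dt O' j (st_shift O' j n (f' u)))).
  have := fe (BasisH H4d n) u.
  under eq_bigr do rewrite slot_actd.
  under [in RHS]eq_bigr do rewrite slot_actd.
  exact.
split; first exact: (exists_lambda epsilon0 mu_inj f'0 fc).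
move=> i; have [j e] := exists_mu beta0 lambda_inj f'0 fc i.
exists j; split=> //.
- exact: (alpha_xi epsilon0 mu0 lambda_inj mu_inj f'0 fL fc e).
- exact: (beta_epsilon lambda_inj mu_inj f'0 fc e).
- exact: (gamma_omega epsilon0 mu0 lambda_inj mu_inj f'0 fa fb fc fd e).
- exact: (g_h epsilon0 mu0 lambda_inj mu_inj f'0 fa fb fc e).
Qed.

(** Moving the factor [i] to the position [tau i] commutes with the action, since matched factors
    carry the same action. *)
Lemma omega_tensor_iso_reindex (tau : I -> J) (tau' : J -> I) :
  cancel tau tau' -> cancel tau' tau ->
  (forall i, [/\ alpha i = xi (tau i), beta i = epsilon (tau i),
     gamma i = omega (tau i), lambda i = mu (tau i) & g i = h (tau i)]) ->
  lieModule_iso V W.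
Proof.
move=> tauK tau'K e.
pose rx : {linear poly_tensor F I -> poly_tensor F J} :=
  tensor_reindex_linear (poly_st F : lmodType F) tauK tau'K.
have rxK : cancel rx (tensor_reindex tau) by exact: tensor_reindexK.
have rx'K : cancel (tensor_reindex tau) rx by exact: tensor_reindexK.
have rx_bij : bijective rx by exists (tensor_reindex tau).
have rx_act x u : rx (tensor_act (V := VO) x u) = tensor_act (V := WO) x (rx u).
  rewrite (omega_tensor_act alpha gamma g beta0 lambda0).
  rewrite (omega_tensor_act xi omega h epsilon0 mu0).
  rewrite linear_sum (reindex tau); last by apply: onW_bij; exists tau'.
  apply: eq_bigr => i _; have [-> -> -> -> ->] := e i.
  exact: tensor_reindex_slot.
by exists (rx : {linear V -> W}); split; [exact: rx_bij | exact: rx_act].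
Qed.

End OmegaIso.

Theorem theorem4p6 (R : realType) (m r : nat)
    (alpha beta gamma lambda : 'I_m -> R[i]) (g : 'I_m -> {poly R[i]})
    (xi epsilon omega mu : 'I_r -> R[i]) (h : 'I_r -> {poly R[i]})
    (m_gt0 : (0 < m)%N) (r_gt0 : (0 < r)%N)
    (beta_neq0 : forall k, beta k != 0) (lambda_neq0 : forall k, lambda k != 0)
    (lambda_inj : injective lambda)
    (epsilon_neq0 : forall k, epsilon k != 0) (mu_neq0 : forall k, mu k != 0)
    (mu_inj : injective mu) :
  lieModule_iso
    (tensor_module (fun k : 'I_m =>
       Omega (alpha k) (beta k) (gamma k) (lambda k) (g k)
             (beta_neq0 k) (lambda_neq0 k)))
    (tensor_module (fun k : 'I_r =>
       Omega (xi k) (epsilon k) (omega k) (mu k) (h k)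
             (epsilon_neq0 k) (mu_neq0 k)))
  <->
  exists (eq_mr : m = r) (sigma : 'S_m), forall k : 'I_m,
    let j := cast_ord eq_mr (sigma k) in
    [/\ alpha k = xi j, beta k = epsilon j, gamma k = omega j,
        lambda k = mu j & g k = h j].
Proof.
split=> [|[eq_mr [sigma params]]]; last first.
  apply: (@omega_tensor_iso_reindex _ _ _ _ _ _ _ _ _ _ _ _ _ _ _ _ _
    (fun k => cast_ord eq_mr (sigma k))
    (fun j => sigma^-1%g (cast_ord (esym eq_mr) j))) => [k|j|k].
  - by rewrite cast_ordK permK.
  - by rewrite permKV cast_ordKV.
  - exact: params.
case/omega_tensor_iso_params => // ex_lambda /fin_all_exists[tau params].
(* [tau k] determines [lambda k], which determines [k]. *)
have tau_inj : injective tau.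
  move=> k k' e; apply: lambda_inj.
  by have [_ _ _ -> _] := params k; have [_ _ _ -> _] := params k'; rewrite e.
have [tau' tau'E] := fin_all_exists ex_lambda.
have tau'_inj : injective tau'.
  by move=> j j' e; apply: mu_inj; rewrite -!tau'E e.
(* Injections in both directions bound each number of factors by the other. *)
have eq_mr : m = r.
  apply/eqP; rewrite eqn_leq.
  have := leq_card tau tau_inj; have := leq_card tau' tau'_inj.
  by rewrite !card_ord => -> ->.
(* Carried back to ['I_m] along [eq_mr], [tau] is an injective self-map of a finite set, hence a
   permutation. *)
have sigma_inj : injective (fun k => cast_ord (esym eq_mr) (tau k)).
  by move=> k k' /cast_ord_inj/tau_inj.
exists eq_mr, (perm sigma_inj) => k /=.
by rewrite permE cast_ordKV.
Qed.
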